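(* Let $m,n\in\mathbb{N}$ with $\max(m,n)>1$, let $d=m+n$, and let $\rho,\sigma$ be norms on $\mathbb{R}^m$ and $\mathbb{R}^n$ respectively. Let $\eta$ be the norm on $\mathbb{R}^d=\mathbb{R}^m\times\mathbb{R}^n$ given by $\eta\big((\mathbf{y},\mathbf{z})\big)=\max\big(\rho(\mathbf{y}),\sigma(\mathbf{z})\big)$, and let $F=\{g_t:t\ge0\}$ with $$g_t=\begin{pmatrix} e^{t/m}I_m&0\\0&e^{-t/n}I_n\end{pmatrix}.$$ Let $x_0\in X_d$ be such that $\lambda^F_\eta(x_0)>0$ (equivalently, $Fx_0$ is bounded). Then for any $x\in X_d$ and any non-empty open interval $I$ containing $\lambda^F_\eta(x_0)$, the set $$\{A\in M_{m,n}(\mathbb{R}):\lambda^F_\eta(u_Ax)\in I\}$$ is dense in $M_{m,n}(\mathbb{R})$.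
   Context: $M_{m,n}(\mathbb{R})$ is the space of real $m\times n$ matrices with its usual topology. $X_d=\mathrm{SL}_d(\mathbb{R})/\mathrm{SL}_d(\mathbb{Z})$ is identified with the space of unimodular lattices in $\mathbb{R}^d$ via $g\,\mathrm{SL}_d(\mathbb{Z})\mapsto g\mathbb{Z}^d$; a subset of $X_d$ is bounded if it is relatively compact. For $x\in X_d$, $\delta_\eta(x):=\inf_{\mathbf{v}\in x\setminus\{0\}}\eta(\mathbf{v})$ and $\lambda^F_\eta(x):=\liminf_{t\to\infty}\delta_\eta(g_tx)^d$. For $A\in M_{m,n}(\mathbb{R})$, $u_A:=\begin{pmatrix} I_m&A\\0&I_n\end{pmatrix}\in\mathrm{SL}_d(\mathbb{R})$. *)

(* Defs.v *)
From HB Require Import structures.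
From mathcomp Require Import all_boot all_order all_algebra.
From mathcomp Require Import all_classical all_reals all_analysis.

Set Implicit Arguments.
Unset Strict Implicit.
Unset Printing Implicit Defensive.

Import Order.TTheory GRing.Theory Num.Theory.
Import numFieldNormedType.Exports.

Local Open Scope classical_set_scope.
Local Open Scope ring_scope.

(* The library has no bundled norms on an arbitrary left module; nonnegativity
   and N 0 = 0 follow from the three clauses below. *)
Definition is_norm (R : realType) (V : lmodType R) (N : V -> R) : Prop :=
  [/\ forall u v, N (u + v) <= N u + N v,
      forall (a : R) v, N (a *: v) = `|a| * N v
    & forall v, N v = 0 -> v = 0].

(* R^d is the type of column vectors, on which matrices act on the left. *)
Definition SL (R : realType) (d : nat) : set 'M[R]_d := [set g | \det g = 1].

(* g Z^d *)
Definition lattice_of (R : realType) (d : nat) (g : 'M[R]_d) : set 'cV[R]_d :=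
  range (fun z : 'cV[int]_d => g *m map_mx intr z).

(* X_d, each coset g SL_d(Z) being identified with the lattice g Z^d. *)
Definition unimodular_lattices (R : realType) (d : nat) : set (set 'cV[R]_d) :=
  @lattice_of R d @` @SL R d.

Definition lattice_act (R : realType) (d : nat)
    (g : 'M[R]_d) (x : set 'cV[R]_d) : set 'cV[R]_d := mulmx g @` x.

Definition eta_norm (R : realType) (m n : nat)
    (rho : 'cV[R]_m -> R) (sigma : 'cV[R]_n -> R) (v : 'cV[R]_(m + n)) : R :=
  Num.max (rho (usubmx v)) (sigma (dsubmx v)).

Definition g_flow (R : realType) (m n : nat) (t : R) : 'M[R]_(m + n) :=
  block_mx (expR (t / m%:R))%:M 0 0 (expR (- t / n%:R))%:M.

Definition u_mx (R : realType) (m n : nat) (A : 'M[R]_(m, n)) : 'M[R]_(m + n) :=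
  block_mx 1%:M A 0 1%:M.

(* The infimum is that of a set of nonnegative reals, nonempty when 0 < d and x
   is a lattice. *)
Definition delta (R : realType) (d : nat)
    (eta : 'cV[R]_d -> R) (x : set 'cV[R]_d) : R :=
  inf (eta @` (x `\ 0)).

Definition lambdaF (R : realType) (m n : nat)
    (eta : 'cV[R]_(m + n) -> R) (x : set 'cV[R]_(m + n)) : \bar R :=
  limf_einf
    (fun t : R => ((delta eta (lattice_act (g_flow m n t) x)) ^+ (m + n))%:E)
    (pinfty_nbhs R).

(* Main.v *)
(* Let C be the group of matrices [[1, 0], [c, 1]], which g_t contracts, and
   x_0 = g_0 Z^d. If p = [[a, 0], [c, b]] then g_t p g_(-t) tends to diag(a, b), so the
   liminf for p x_0 is close to that for x_0 as soon as a and b are close to 1, whatever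
   c is. It is therefore enough to find A close to a given B such that u_A x = p x_0 for
   some such p, and this holds once the orbit C x_0 is dense in X_d.

   Density of C x_0. As the liminf is positive, Mahler's criterion gives bases k_t of
   g_t x_0 with bounded entries; let k be a limit of k_t along an ultrafilter finer than
   t -> +oo. Suppose that integer unimodular matrices G_t satisfy
   e^(-t/m) G_t -> [[u, 0], [0, 0]] and e^(-t/n) G_t^-1 -> [[0, 0], [0, v]]. Then
   Y_t = g_(-t) k_t G_t is a basis of x_0 whose upper rows converge to (k_11 u, 0), while
   the right columns of Y_t^-1 converge to (0, v (k^-1)_22); hence, modulo C, Y_t converges
   to diag(k_11 u, (v (k^-1)_22)^-1). The matrices G_t are products of companion-like
   integer matrices for diagonal u and v, and Smith normal forms of rational
   approximations give all u, v with |det u| = |det v|. So the closure of C x_0 contains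
   every block diagonal lattice, hence P Z^d, where P is the group of block lower
   triangular matrices; finally P GL_d(Z) is dense, again by the Smith normal form. *)
Require Import Defs.
From HB Require Import structures.
From mathcomp Require Import all_boot all_order all_algebra.
From mathcomp Require Import all_classical all_reals all_analysis.
From mathcomp Require Import perm ring lra.
Import Order.TTheory GRing.Theory Num.Theory.
Import numFieldNormedType.Exports.
Local Open Scope classical_set_scope.
Local Open Scope ring_scope.

Set Implicit Arguments.
Unset Strict Implicit.
Unset Printing Implicit Defensive.

(** * Entrywise limits of matrices *)

(** Convergence is asked entry by entry along an arbitrary filter, so that the same lemmas serve for
    a real parameter at infinity, for sequences and for ultrafilters. *)
Definition mxlim (T : Type) (F : set_system T) (R : realType) (m n : nat)
    (f : T -> 'M[R]_(m, n)) (A : 'M[R]_(m, n)) : Prop :=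
  forall i j, f x i j @[x --> F] --> A i j.

Lemma cvg_ext (T : Type) (F : set_system T) (R : realType) (f g : T -> R) (l : R) :
  (forall x, f x = g x) -> g x @[x --> F] --> l -> f x @[x --> F] --> l.
Proof. by move=> /funext ->. Qed.

Section MatrixLimits.
Context (T : Type) (F : set_system T) {FF : Filter F} (R : realType).

Lemma cvgr_sum (I : Type) (r : seq I) (P : pred I) (f : I -> T -> R) (l : I -> R) :
  (forall i, P i -> f i x @[x --> F] --> l i) ->
  (\sum_(i <- r | P i) f i x) @[x --> F] --> \sum_(i <- r | P i) l i.
Proof. by move=> fl; apply: cvg_big => //; exact: add_continuous. Qed.

Lemma cvgr_prod (I : Type) (r : seq I) (P : pred I) (f : I -> T -> R) (l : I -> R) :
  (forall i, P i -> f i x @[x --> F] --> l i) ->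
  (\prod_(i <- r | P i) f i x) @[x --> F] --> \prod_(i <- r | P i) l i.
Proof. by move=> fl; apply: cvg_big => //; exact: mul_continuous. Qed.

Lemma mxlim_ext m n (f g : T -> 'M[R]_(m, n)) A :
  (forall x, f x = g x) -> mxlim F g A -> mxlim F f A.
Proof. by move=> /funext ->. Qed.

Lemma mxlim_near m n (f g : T -> 'M[R]_(m, n)) A :
  (\forall x \near F, f x = g x) -> mxlim F g A -> mxlim F f A.
Proof.
move=> fg gA i j; apply: cvg_trans (gA i j); apply: near_eq_cvg.
by apply: filterS fg => x ->.
Qed.

Lemma mxlim_cst m n (A : 'M[R]_(m, n)) : mxlim F (fun=> A) A.
Proof. by move=> i j; exact: cvg_cst. Qed.

Lemma mxlimD m n (f g : T -> 'M[R]_(m, n)) A B :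
  mxlim F f A -> mxlim F g B -> mxlim F (fun x => f x + g x) (A + B).
Proof.
move=> fA gB i j; rewrite mxE; apply: cvg_ext (cvgD (fA i j) (gB i j)) => x.
by rewrite mxE.
Qed.

Lemma mxlimN m n (f : T -> 'M[R]_(m, n)) A :
  mxlim F f A -> mxlim F (fun x => - f x) (- A).
Proof.
move=> fA i j; rewrite mxE; apply: cvg_ext (cvgN (fA i j)) => x.
by rewrite mxE.
Qed.

Lemma mxlimZ m n (s : T -> R) (f : T -> 'M[R]_(m, n)) (a : R) A :
  s x @[x --> F] --> a -> mxlim F f A -> mxlim F (fun x => s x *: f x) (a *: A).
Proof.
move=> sa fA i j; rewrite mxE; apply: cvg_ext (cvgM sa (fA i j)) => x.
by rewrite mxE.
Qed.

Lemma mxlimM m n p (f : T -> 'M[R]_(m, n)) (g : T -> 'M[R]_(n, p)) A B :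
  mxlim F f A -> mxlim F g B -> mxlim F (fun x => f x *m g x) (A *m B).
Proof.
move=> fA gB i j; rewrite mxE.
apply: (@cvg_ext _ _ _ _ (fun x => \sum_k f x i k * g x k j)) => [x|].
  by rewrite mxE.
by apply: cvgr_sum => k _; exact: cvgM.
Qed.

Lemma mxlim_block m1 m2 n1 n2 (f11 : T -> 'M[R]_(m1, n1)) (f12 : T -> 'M[R]_(m1, n2))
    (f21 : T -> 'M[R]_(m2, n1)) (f22 : T -> 'M[R]_(m2, n2)) A B C D :
  mxlim F f11 A -> mxlim F f12 B -> mxlim F f21 C -> mxlim F f22 D ->
  mxlim F (fun x => block_mx (f11 x) (f12 x) (f21 x) (f22 x)) (block_mx A B C D).
Proof.
move=> hA hB hC hD i j.
by case: (split_ordP i) => i' ->; case: (split_ordP j) => j' ->;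
   rewrite ?block_mxEul ?block_mxEur ?block_mxEdl ?block_mxEdr;
   [apply: cvg_ext (hA i' j')|apply: cvg_ext (hB i' j')
   |apply: cvg_ext (hC i' j')|apply: cvg_ext (hD i' j')] => x;
   rewrite ?block_mxEul ?block_mxEur ?block_mxEdl ?block_mxEdr.
Qed.

Lemma mxlim_ulsub m1 m2 n1 n2 (f : T -> 'M[R]_(m1 + m2, n1 + n2)) A :
  mxlim F f A -> mxlim F (fun x => ulsubmx (f x)) (ulsubmx A).
Proof.
move=> fA i j; rewrite !mxE; apply: cvg_ext (fA _ _) => x.
by rewrite !mxE.
Qed.

Lemma mxlim_ursub m1 m2 n1 n2 (f : T -> 'M[R]_(m1 + m2, n1 + n2)) A :
  mxlim F f A -> mxlim F (fun x => ursubmx (f x)) (ursubmx A).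
Proof.
move=> fA i j; rewrite !mxE; apply: cvg_ext (fA _ _) => x.
by rewrite !mxE.
Qed.

Lemma mxlim_dlsub m1 m2 n1 n2 (f : T -> 'M[R]_(m1 + m2, n1 + n2)) A :
  mxlim F f A -> mxlim F (fun x => dlsubmx (f x)) (dlsubmx A).
Proof.
move=> fA i j; rewrite !mxE; apply: cvg_ext (fA _ _) => x.
by rewrite !mxE.
Qed.

Lemma mxlim_drsub m1 m2 n1 n2 (f : T -> 'M[R]_(m1 + m2, n1 + n2)) A :
  mxlim F f A -> mxlim F (fun x => drsubmx (f x)) (drsubmx A).
Proof.
move=> fA i j; rewrite !mxE; apply: cvg_ext (fA _ _) => x.
by rewrite !mxE.
Qed.

Lemma cvg_det n (f : T -> 'M[R]_n) A :
  mxlim F f A -> \det (f x) @[x --> F] --> \det A.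
Proof.
move=> fA; rewrite /determinant; apply: cvgr_sum => s _.
by apply: cvgM; [exact: cvg_cst|apply: cvgr_prod => i _; exact: fA].
Qed.

Lemma mxlim_adj n (f : T -> 'M[R]_n) A :
  mxlim F f A -> mxlim F (fun x => \adj (f x)) (\adj A).
Proof.
move=> fA i j; rewrite mxE; apply: cvg_ext (cvgM (cvg_cst _) (cvg_det _)) => [x|].
  by rewrite mxE.
by move=> k l; rewrite !mxE; apply: cvg_ext (fA _ _) => x; rewrite !mxE.
Qed.

Lemma near_det_neq0 n (f : T -> 'M[R]_n) A :
  mxlim F f A -> \det A != 0 -> \forall x \near F, \det (f x) != 0.
Proof. by move=> /cvg_det + A0 => /cvgr_neq0; apply. Qed.

Lemma mxlim_inv n (f : T -> 'M[R]_n) A :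
  mxlim F f A -> \det A != 0 -> mxlim F (fun x => invmx (f x)) (invmx A).
Proof.
move=> fA A0.
(* [invmx] returns a singular matrix unchanged, so the cofactor formula is available only near [F],
   where the determinant is nonzero. *)
apply: (@mxlim_near _ _ _ (fun x => (\det (f x))^-1 *: \adj (f x))).
  by apply: filterS (near_det_neq0 fA A0) => x fx; rewrite /invmx unitmxE unitfE fx.
rewrite /invmx unitmxE unitfE A0; apply: mxlimZ (mxlim_adj fA).
exact: (cvgV A0 (cvg_det fA)).
Qed.

Lemma mxlim_dist m n (f : T -> 'M[R]_(m, n)) A e : 0 < e ->
  mxlim F f A -> \forall x \near F, forall i j, `|A i j - f x i j| < e.
Proof.
move=> e0 fA; apply: filter_forall => i; apply: filter_forall => j.
exact: cvgr_dist_lt (fA i j) _ e0.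
Qed.

End MatrixLimits.

Arguments mxlim_cst {T F FF R m n} A.

Lemma fmap_ultra (T U : Type) (F : set_system T) (f : T -> U) :
  UltraFilter F -> UltraFilter (f @ F).
Proof.
move=> FU; split=> [|G GP FG]; first exact: fmap_proper_filter.
rewrite predeqE => A; split=> [GA|]; last exact: FG.
have [//|FnA] := in_ultra_setVsetC (f @^-1` A) FU; have GnA := FG (~` A) FnA.
by have /filter_ex[? []] : G (A `&` ~` A) by exact: filterI.
Qed.

(* Ultrafilters replace the compactness of bounded sets of matrices: every entry
   converges separately, without extracting subsequences. *)
Lemma ultra_bounded_mxlim (T : Type) (F : set_system T) (FF : UltraFilter F)
    (R : realType) (m n : nat) (f : T -> 'M[R]_(m, n)) (K : R) :
  (\forall x \near F, forall i j, `|f x i j| <= K) ->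
  exists A, mxlim F f A.
Proof.
move=> fK; have PF := ultra_proper.
suff /choice[a fa] : forall ij : 'I_m * 'I_n,
    exists l : R, f x ij.1 ij.2 @[x --> F] --> l.
  by exists (\matrix_(i, j) a (i, j)) => i j; rewrite mxE; exact: (fa (i, j)).
move=> [i j] /=.
have := @segment_compact R (- K) K; rewrite compact_ultra.
move=> /(_ _ (fmap_ultra (fun x => f x i j) FF)) [].
  by apply: filterS fK => x /(_ i j); rewrite /= in_itv /= ler_norml.
by move=> l [_ fl]; exists l.
Qed.

(** * Integer unimodular matrices with prescribed asymptotics *)

(* One round of a Euclid-like recursion on columns [s, l_0, .., l_n], with [s] small and
   the [l_j] large: [l_j] becomes [x_j l_j - l_(j-1)], where [l_(-1) = s], and the former
   [l_n] becomes the small column. The matrices [step_mx], [step_first] and [step_last]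
   describe this round; [step_col], [step_row] and [step_tri] describe its inverse. *)
Section CompanionStep.
Context (K : comPzRingType) (n : nat) (x : nat -> K).

(** Solutions of w_(j+1) - x_j w_j = b_j: [step_pi] starts from w_0 = 1 with b = 0, while [step_tau]
    in j starts from 0 with b the indicator of k. *)
Definition step_pi (j : nat) : K := \prod_(0 <= l < j) x l.
Definition step_tau (j k : nat) : K :=
  if (k < j)%N then \prod_(k.+1 <= l < j) x l else 0.

Definition step_mx : 'M[K]_n.+1 :=
  \matrix_(i, j) ((x i) *+ (i == j) - ((i.+1 == j :> nat)%N)%:R).
Definition step_first : 'rV[K]_n.+1 := \row_j ((j == 0 :> nat)%:R).
Definition step_last : 'cV[K]_n.+1 := \col_i ((i == n :> nat)%:R).
Definition step_col : 'cV[K]_n.+1 := \col_j step_pi j.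
Definition step_row : 'rV[K]_n.+1 := \row_k step_tau n.+1 k.
Definition step_tri : 'M[K]_n.+1 := \matrix_(j, k) step_tau j k.

Lemma step_first_mul p (v : 'M[K]_(n.+1, p)) i k : (step_first *m v) i k = v ord0 k.
Proof.
rewrite mxE (bigD1 ord0) //= big1 => [|j j0]; first by rewrite mxE eqxx mul1r addr0.
by rewrite mxE -[_ == _ :> nat]/(j == ord0) (negPf j0) mul0r.
Qed.

(** The last row of [step_mx] has no superdiagonal entry; the [step_last] term compensates for the
    w_(n+1) subtracted there. *)
Lemma step_mx_mul p (w : nat -> 'I_p -> K) :
  step_mx *m (\matrix_(j, k) w j k) =
  \matrix_(i, k) (x i * w i k - w i.+1 k) + step_last *m (\row_k w n.+1 k).
Proof.
apply/matrixP => i k; rewrite !mxE big_ord1 !mxE.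
under eq_bigr => j _ do rewrite !mxE mulrBl.
rewrite sumrB (bigD1 i) //= eqxx mulr1n big1 => [|j]; last first.
  by rewrite eq_sym => /negPf ->; rewrite mulr0n mul0r.
rewrite addr0 -addrA; congr (_ + _).
have [->|i_n] := eqVneq (i : nat) n.
  rewrite mul1r addNr big1 ?oppr0// => j _.
  by rewrite (gtn_eqF (ltn_ord j)) mul0r.
have i1n : (i.+1 < n.+1)%N by rewrite ltnS ltn_neqAle i_n -ltnS ltn_ord.
rewrite (bigD1 (Ordinal i1n)) //= eqxx !mul1r mul0r addr0 big1 ?addr0// => j ji.
by move: ji; rewrite -val_eqE /= eq_sym => /negPf ->; rewrite mul0r.
Qed.

Lemma step_first_col : step_first *m step_col = 1%:M.
Proof.
apply/matrixP => i k; rewrite step_first_mul !mxE /step_pi big_nil.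
by rewrite !ord1 eqxx.
Qed.

Lemma step_first_tri : step_first *m step_tri = 0.
Proof. by apply/matrixP => i k; rewrite step_first_mul !mxE. Qed.

Lemma step_mx_col : step_mx *m step_col = step_last *m (step_pi n.+1)%:M.
Proof.
have -> : step_col = \matrix_(j < n.+1, k < 1) step_pi j.
  by apply/matrixP => i j; rewrite !mxE.
rewrite (step_mx_mul (fun j _ => step_pi j)).
rewrite [X in X + _](_ : _ = 0) ?add0r.
  by congr (_ *m _); apply/matrixP => i j; rewrite !ord1 !mxE eqxx.
apply/matrixP => i j; rewrite !mxE /step_pi big_nat_recr //=.
by rewrite mulrC subrr.
Qed.

Lemma step_mx_tri : step_last *m step_row - step_mx *m step_tri = 1%:M.
Proof.
rewrite (step_mx_mul step_tau) -/step_row opprD addrCA subrr addr0.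
apply/matrixP => i k; rewrite !mxE opprB /step_tau ltnS -val_eqE /= [(k <= i)%N]leq_eqVlt.
have [ik|/= ik] := eqVneq (k : nat) i.
  by rewrite /= ik ltnn mulr0 subr0 big_geq.
case: ltnP => ki; last by rewrite mulr0 subr0.
by rewrite [in X in X - _]big_nat_recr //= mulrC subrr.
Qed.

(** The first factor is (1 + M) T, where 1 + M is the block sum and T = [[0, -first],
    [last, step_mx]] mixes the new column with the last n+1 ones. The second factor is T^-1 (1 +
    M^-1), with T^-1 = [[pi, row], [-col, -tri]]. *)
Lemma companion_step m (A : 'M[K]_m) (B : 'M[K]_(m, n.+1)) (C : 'M[K]_(n.+1, m))
    (D : 'M[K]_n.+1) (P : 'M[K]_m) (Q : 'M[K]_(m, n.+1))
    (S : 'M[K]_(n.+1, m)) (U : 'M[K]_n.+1) :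
  block_mx A B C D *m block_mx P Q S U = 1%:M ->
  block_mx (block_mx (0 : 'M[K]_1) 0 (B *m step_last) A)
           (col_mx (- step_first) (B *m step_mx))
           (row_mx (D *m step_last) C)
           (D *m step_mx) *m
  block_mx (block_mx (step_pi n.+1)%:M (step_row *m S) 0 P)
           (col_mx (step_row *m U) Q)
           (row_mx (- step_col) (- (step_tri *m S)))
           (- (step_tri *m U)) = 1%:M :> 'M[K]_(1 + m + n.+1).
Proof.
rewrite mulmx_block [X in _ = X]scalar_mx_block => /eq_block_mx[h11 h12 h21 h22].
have key p q (M : 'M[K]_(p, n.+1)) (N : 'M[K]_(n.+1, q)) :
    M *m step_last *m step_row *m N = M *m N + M *m step_mx *m step_tri *m N.
  apply/eqP; rewrite -subr_eq -!mulmxA -mulmxBr; apply/eqP; congr (_ *m _).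
  by rewrite !mulmxA -mulmxBl step_mx_tri mul1mx.
rewrite [X in _ = X]scalar_mx_block mulmx_block mulmx_block mul_mx_row mul_block_col.
rewrite !mul_col_mx mul_row_block mul_row_col.
rewrite -block_mxEh add_block_mx add_col_mx mul_mx_row add_row_mx.
rewrite !(mulmxN, mulNmx, mul0mx, mulmx0, addr0, add0r, opprK).
rewrite step_first_col !(mulmxA step_first) step_first_tri !mul0mx ?addr0 ?add0r.
rewrite -!(mulmxA _ _ step_col) step_mx_col !mulmxA !subrr !key.
have cancel p q (a b c : 'M[K]_(p, q)) : a + b + c - b = a + c.
  by rewrite addrAC addrK.
rewrite !cancel.
rewrite ![_ + A *m _]addrC ![_ + C *m _]addrC h11 h12 h21 h22.
by rewrite col_mx0 row_mx0 [X in _ = block_mx X _ _ _]scalar_mx_block.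
Qed.
End CompanionStep.

(** * Growth rates of the companion products *)

Section CompanionLimits.
Context (R : realType).
Local Notation zmx := (map_mx (intr : int -> R)).

Lemma cvg_inv_pinfty : X^-1 @[X --> (+oo : set_system R)] --> (0 : R).
Proof.
apply/gtr0_cvgV0; first exact: nbhs_pinfty_gt.
exact: cvg_id.
Qed.

Lemma cvg_floor_ratio (a : R) :
  X^-1 * (Num.floor (X * a))%:~R @[X --> (+oo : set_system R)] --> a.
Proof.
apply: (@squeeze_cvgr _ _ _ _ (fun X => a - X^-1) (fun=> a)).
- near=> X; have X0 : 0 < X by near: X; exact: nbhs_pinfty_gt.
  rewrite ler_pdivlMl// mulrBr mulfV ?gt_eqF// ler_pdivrMl// floor_le.
  by rewrite lerBlDr -(intrD _ _ 1) ltW// floorD1_gt.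
- rewrite -[X in _ --> X]subr0; apply: cvgB; first exact: cvg_cst.
  exact: cvg_inv_pinfty.
- exact: cvg_cst.
Unshelve. all: by end_near. Qed.

Arguments cvg_floor_ratio a : clear implicits.

Lemma cvg_inv_prod (r : nat -> R) (a b : nat) :
  X^-1 ^+ (b - a) * (\prod_(a <= l < b) Num.floor (X * r l))%:~R
    @[X --> (+oo : set_system R)] --> \prod_(a <= l < b) r l.
Proof.
apply: (@cvg_ext _ _ _ _
  (fun X => \prod_(a <= l < b) (X^-1 * (Num.floor (X * r l))%:~R))) => [X|].
  by rewrite big_split /= prodr_const_nat rmorph_prod.
by apply: cvgr_prod => l _; exact: cvg_floor_ratio.
Qed.

Lemma cvg_inv_exp_0 k (f : R -> R) (l : R) :
  f X @[X --> (+oo : set_system R)] --> l ->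
  X^-1 ^+ k.+1 * f X @[X --> (+oo : set_system R)] --> (0 : R).
Proof.
move=> fl; elim: k => [|k IH].
  by rewrite -(mul0r l); apply: cvgM => //; exact: cvg_inv_pinfty.
rewrite -(mul0r 0); apply: cvg_ext (cvgM cvg_inv_pinfty IH) => X.
by rewrite exprS mulrA.
Qed.

Lemma mxlim_col m1 m2 n (f : R -> 'M[R]_(m1, n)) (g : R -> 'M[R]_(m2, n)) A B :
  mxlim +oo f A -> mxlim +oo g B ->
  mxlim +oo (fun X => col_mx (f X) (g X)) (col_mx A B).
Proof.
by move=> fA gB i j; case: (split_ordP i) => i' ->; rewrite ?col_mxEu ?col_mxEd;
   [apply: cvg_ext (fA i' j)|apply: cvg_ext (gB i' j)] => x;
   rewrite ?col_mxEu ?col_mxEd.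
Qed.

Lemma mxlim_row m n1 n2 (f : R -> 'M[R]_(m, n1)) (g : R -> 'M[R]_(m, n2)) A B :
  mxlim +oo f A -> mxlim +oo g B ->
  mxlim +oo (fun X => row_mx (f X) (g X)) (row_mx A B).
Proof.
by move=> fA gB i j; case: (split_ordP j) => j' ->; rewrite ?row_mxEl ?row_mxEr;
   [apply: cvg_ext (fA i j')|apply: cvg_ext (gB i j')] => x;
   rewrite ?row_mxEl ?row_mxEr.
Qed.

(** Weights for the lower blocks [S] and [U] of the inverse: their row j is o(X^(j+1)), a graded
    bound that every round preserves. *)
Definition powers_mx n (X : R) : 'M[R]_n := diag_mx (\row_j X ^+ j.+1).

Lemma powers_mxV n X : X != 0 -> powers_mx n X *m powers_mx n X^-1 = 1%:M.
Proof.
move=> X0; rewrite mulmx_diag -diag_const_mx; congr diag_mx.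
by apply/rowP => j; rewrite !mxE -exprMn mulfV// expr1n.
Qed.

Lemma mxlim_exp_cst m n k (M : 'M[R]_(m, n)) :
  mxlim +oo (fun X => X^-1 ^+ k.+1 *: M) 0.
Proof.
move=> i j; rewrite [X in _ --> X]mxE.
by apply: cvg_ext (cvg_inv_exp_0 k (cvg_cst (M i j))) => X; rewrite mxE.
Qed.

Section Step.
Context (n : nat) (r : nat -> R).
Let x (X : R) (l : nat) : int := Num.floor (X * r l).

Lemma mxlim_step_mx :
  mxlim +oo (fun X => X^-1 *: zmx (step_mx n (x X))) (diag_mx (\row_j r j)).
Proof.
move=> i j; rewrite !mxE.
apply: (@cvg_ext _ _ _ _ (fun X => (X^-1 * (x X i)%:~R) *+ (i == j) -
    X^-1 ^+ 1 * (i.+1 == j :> nat)%:R)) => [X|].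
  rewrite !mxE rmorphB /= rmorphMn /= mulrBr mulrnAr expr1.
  by rewrite !mulrnAr; case: (_ == j :> nat)%N; rewrite ?mulr0n ?mulr1n ?mulr0 ?mulr1.
have xr : X^-1 * (x X i)%:~R *+ (i == j) @[X --> (+oo : set_system R)] --> r i *+ (i == j).
  rewrite -mulr_natr; apply: cvg_ext (cvgM (cvg_floor_ratio (r i)) (cvg_cst _)) => X.
  by rewrite mulr_natr.
rewrite -(subr0 (r i *+ _)).
exact: cvgB xr (cvg_inv_exp_0 0 (cvg_cst ((i.+1 == j :> nat)%:R : R))).
Qed.

Lemma mxlim_step_tau j (k : nat) : (j <= n.+1)%N ->
  X^-1 ^+ (j - k.+1) * (step_tau (x X) j k)%:~R @[X --> (+oo : set_system R)] -->
   (if (k < j)%N then \prod_(k.+1 <= l < j) r l else 0).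
Proof.
move=> jn; rewrite /step_tau; case: ifP => _; first exact: cvg_inv_prod.
by apply: cvg_ext (cvg_cst _) => X; rewrite mulr0.
Qed.

(** Entry k of [step_row] is a product of n-k factors of order X and row k of [V] is o(X^(k+1)),
    hence the total o(X^(n+1)). *)
Lemma mxlim_step_row p (V : R -> 'M[R]_(n.+1, p)) :
  mxlim +oo (fun X => powers_mx _ X^-1 *m V X) 0 ->
  mxlim +oo (fun X => X^-1 ^+ n.+1 *: (zmx (step_row n (x X)) *m V X)) 0.
Proof.
move=> V0; rewrite -(@mulmx0 R 1 n.+1 p (\row_k \prod_(k.+1 <= l < n.+1) r l)).
apply: (@mxlim_near _ _ _ _ _ _ _ (fun X => (X^-1 ^+ n.+1 *:
    (zmx (step_row n (x X)) *m powers_mx _ X)) *m (powers_mx _ X^-1 *m V X))).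
  near=> X; have X0 : 0 < X by near: X; exact: nbhs_pinfty_gt.
  by rewrite -scalemxAl !mulmxA -(mulmxA _ (powers_mx _ X)) powers_mxV ?gt_eqF// mulmx1.
apply: mxlimM V0.
apply: (@mxlim_near _ _ _ _ _ _ _
    (fun X => \row_k (X^-1 ^+ (n.+1 - k.+1) * (step_tau (x X) n.+1 k)%:~R))).
  near=> X; have X0 : 0 < X by near: X; exact: nbhs_pinfty_gt.
  apply/rowP => k; rewrite mul_mx_diag !mxE mulrCA mulrC; congr (_ * _).
  rewrite -{1}(subnK (ltn_ord k)) exprD -mulrA -exprMn mulVf ?gt_eqF//.
  by rewrite expr1n mulr1.
move=> i k; rewrite [X in _ --> X]mxE.
have := @mxlim_step_tau n.+1 k (leqnn _); rewrite ltn_ord.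
by apply: cvg_ext => X; rewrite mxE.
Unshelve. all: by end_near. Qed.

(** Below the diagonal, entry (j, k) of [step_tri] has order X^(j-k-1); conjugation by the weights
    turns this into X^-1, which tends to 0. *)
Lemma mxlim_step_tri p (V : R -> 'M[R]_(n.+1, p)) :
  mxlim +oo (fun X => powers_mx _ X^-1 *m V X) 0 ->
  mxlim +oo (fun X => powers_mx _ X^-1 *m (zmx (step_tri n (x X)) *m V X)) 0.
Proof.
move=> V0; rewrite -(@mulmx0 R n.+1 n.+1 p 0).
apply: (@mxlim_near _ _ _ _ _ _ _ (fun X => (powers_mx _ X^-1 *m
    zmx (step_tri n (x X)) *m powers_mx _ X) *m (powers_mx _ X^-1 *m V X))).
  near=> X; have X0 : 0 < X by near: X; exact: nbhs_pinfty_gt.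
  by rewrite !mulmxA -(mulmxA _ (powers_mx _ X)) powers_mxV ?gt_eqF// mulmx1.
apply: mxlimM V0.
apply: (@mxlim_near _ _ _ _ _ _ _ (fun X => \matrix_(j, k)
    (X^-1 ^+ 1 * (X^-1 ^+ (j - k.+1) * (step_tau (x X) j k)%:~R)))).
  near=> X; have X0 : 0 < X by near: X; exact: nbhs_pinfty_gt.
  apply/matrixP => j k; rewrite mul_mx_diag mul_diag_mx !mxE /step_tau.
  case: ltnP => [kj|_]; last by rewrite !(mulr0, mul0r).
  rewrite mulrAC mulrA; congr (_ * _).
  rewrite expr1 -{1}(subnK kj) -addSn exprD -mulrA -exprMn mulVf ?gt_eqF//.
  by rewrite expr1n mulr1 exprS.
move=> j k; rewrite [X in _ --> X]mxE.
apply: cvg_ext (cvg_inv_exp_0 0 (@mxlim_step_tau j k (ltnW (ltn_ord j)))) => X.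
by rewrite mxE.
Unshelve. all: by end_near. Qed.

Lemma mxlim_step_col :
  mxlim +oo (fun X => powers_mx _ X^-1 *m zmx (step_col n (x X))) 0.
Proof.
move=> j k; rewrite [X in _ --> X]mxE.
apply: cvg_ext (cvg_inv_exp_0 0 (@cvg_inv_prod r 0 j)) => X.
by rewrite mul_diag_mx !mxE /step_pi subn0 mulrA -exprD add1n.
Qed.

End Step.

(** One round for each row of [r], with x_l the integer part of X r_(i,l). A round multiplies the
    limit of column j of [D] by r_(i,j), at the cost of one factor X, and adds to [P] a diagonal
    entry of order X^(n+1). So [D] records the column products of [r] and [P] its row products. *)
Lemma companion_family m n (r : nat -> nat -> R) :
  exists (A : R -> 'M[int]_m) (B : R -> 'M[int]_(m, n.+1))
         (C : R -> 'M[int]_(n.+1, m)) (D : R -> 'M[int]_n.+1)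
         (P : R -> 'M[int]_m) (Q : R -> 'M[int]_(m, n.+1))
         (S : R -> 'M[int]_(n.+1, m)) (U : R -> 'M[int]_n.+1),
  [/\ forall X, block_mx (A X) (B X) (C X) (D X) *m
                block_mx (P X) (Q X) (S X) (U X) = 1%:M,
      [/\ mxlim +oo (fun X => X^-1 ^+ m *: zmx (A X)) 0,
          mxlim +oo (fun X => X^-1 ^+ m *: zmx (B X)) 0,
          mxlim +oo (fun X => X^-1 ^+ m *: zmx (C X)) 0
        & mxlim +oo (fun X => X^-1 ^+ m *: zmx (D X))
            (diag_mx (\row_j \prod_(0 <= i < m) r i j))],
      mxlim +oo (fun X => X^-1 ^+ n.+1 *: zmx (P X))
        (diag_mx (\row_i \prod_(0 <= j < n.+1) r i j)),
      mxlim +oo (fun X => X^-1 ^+ n.+1 *: zmx (Q X)) 0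
    & mxlim +oo (fun X => powers_mx _ X^-1 *m zmx (S X)) 0 /\
      mxlim +oo (fun X => powers_mx _ X^-1 *m zmx (U X)) 0].
Proof.
elim: m r => [|m IH] r.
  exists (fun=> 1%:M), (fun=> 0), (fun=> 0), (fun=> 1%:M),
         (fun=> 1%:M), (fun=> 0), (fun=> 0), (fun=> 1%:M).
  split=> [X| | | |].
  - by rewrite -scalar_mx_block mulmx1.
  - split; [by case|by case|by move=> ? []|].
    apply: (@mxlim_ext _ _ _ _ _ _ (fun=> 1%:M)) => [X|].
      by rewrite expr0 scale1r map_mx1.
    rewrite (_ : diag_mx _ = 1%:M); first exact: mxlim_cst.
    rewrite -diag_const_mx; congr diag_mx; apply/rowP => j.
    by rewrite !mxE big_nil.
  - by case.
  - by case.
  - split; first by move=> ? [].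
    move=> j k; rewrite [X in _ --> X]mxE.
    apply: cvg_ext (cvg_inv_exp_0 j (cvg_cst ((j == k)%:R : R))) => X.
    by rewrite mul_diag_mx !mxE; case: eqP.
have [A [B [C [D [P [Q [S [U]]]]]]]] := IH (fun i => r i.+1).
move=> [ABCD [A0 B0 C0 DD] PP Q0 [S0 U0]].
pose x (X : R) (l : nat) : int := Num.floor (X * r 0%N l).
exists (fun X => block_mx (0 : 'M[int]_1) 0 (B X *m step_last int n) (A X)).
exists (fun X => col_mx (- step_first int n) (B X *m step_mx n (x X))).
exists (fun X => row_mx (D X *m step_last int n) (C X)).
exists (fun X => D X *m step_mx n (x X)).
exists (fun X => block_mx (step_pi (x X) n.+1)%:M (step_row n (x X) *m S X) 0 (P X)).
exists (fun X => col_mx (step_row n (x X) *m U X) (Q X)).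
exists (fun X => row_mx (- step_col n (x X)) (- (step_tri n (x X) *m S X))).
exists (fun X => - (step_tri n (x X) *m U X)).
have lim_cst k l (N : 'M[R]_(k, l)) : mxlim (+oo : set_system R) (fun=> N) N by exact: mxlim_cst.
have expS k l (M : R -> 'M[R]_(k, l)) a L :
    mxlim +oo (fun X => X^-1 ^+ a *: M X) L ->
    mxlim +oo (fun X => X^-1 ^+ a.+1 *: M X) 0.
  move=> ML; rewrite -(scale0r L).
  apply: mxlim_ext (mxlimZ cvg_inv_pinfty ML) => X.
  by rewrite scalerA -exprS.
have lim0G k (M : R -> 'M[int]_(k, n.+1)) :
    mxlim +oo (fun X => X^-1 ^+ m *: zmx (M X)) 0 ->
    mxlim +oo (fun X => X^-1 ^+ m.+1 *: zmx (M X *m step_mx n (x X))) 0.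
  move=> M0; rewrite -(mul0mx _ (diag_mx (\row_j r 0%N j))).
  apply: mxlim_ext (mxlimM M0 (@mxlim_step_mx n (r 0%N))) => X.
  by rewrite map_mxM -scalemxAl -scalemxAr scalerA -exprSr.
have limG k (M : R -> 'M[int]_(k, n.+1)) L :
    mxlim +oo (fun X => X^-1 ^+ m *: zmx (M X)) L ->
    mxlim +oo (fun X => X^-1 ^+ m.+1 *: zmx (M X *m step_mx n (x X)))
      (L *m diag_mx (\row_j r 0%N j)).
  move=> ML; apply: mxlim_ext (mxlimM ML (@mxlim_step_mx n (r 0%N))) => X.
  by rewrite map_mxM -scalemxAl -scalemxAr scalerA -exprSr.
have lim_last k (M : R -> 'M[int]_(k, n.+1)) L :
    mxlim +oo (fun X => X^-1 ^+ m *: zmx (M X)) L ->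
    mxlim +oo (fun X => X^-1 ^+ m.+1 *: zmx (M X *m step_last int n)) 0.
  move=> ML; apply: (expS _ _ _ _ (L *m zmx (step_last int n))).
  apply: mxlim_ext (mxlimM ML (lim_cst _ _ (zmx (step_last int n)))) => X.
  by rewrite map_mxM scalemxAl.
split=> [X| | | |].
- exact: companion_step.
- split.
  + rewrite -(block_mx0 R 1 m 1 m).
    apply: mxlim_ext (mxlim_block (lim_cst 1 1 0) (lim_cst 1 m 0)
        (lim_last _ _ _ B0) (expS _ _ _ _ _ A0)) => X.
    by rewrite (@map_block_mx _ _ _ 1 m 1 m) (@scale_block_mx _ 1 m 1 m) !map_mx0 !scaler0.
  + rewrite -(col_mx0 R 1 m); apply: mxlim_ext (mxlim_col
      (@mxlim_exp_cst 1 n.+1 m (- zmx (step_first int n))) (lim0G _ _ B0)) => X.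
    by rewrite (@map_col_mx _ _ _ 1 m) (@scale_col_mx _ 1 m) map_mxN.
  + rewrite -(row_mx0 R n.+1 1 m).
    apply: mxlim_ext (mxlim_row (lim_last _ _ _ DD) (expS _ _ _ _ _ C0)) => X.
    by rewrite (@map_row_mx _ _ _ _ 1 m) (@scale_row_mx _ _ 1 m).
  + have := limG _ _ _ DD; rewrite mulmx_diag; congr (mxlim _ _ (diag_mx _)).
    by apply/rowP => j; rewrite !mxE big_nat_recl// mulrC.
- have -> : diag_mx (\row_(i < m.+1) \prod_(0 <= j < n.+1) r i j) =
      block_mx (\prod_(0 <= j < n.+1) r 0%N j)%:M 0 0
        (diag_mx (\row_(i < m) \prod_(0 <= j < n.+1) r i.+1 j)) :> 'M[R]_(1 + m).
    apply/matrixP => i j.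
    case: (split_ordP (i : 'I_(1 + m))) => i' ->;
    case: (split_ordP (j : 'I_(1 + m))) => j' ->;
    rewrite ?block_mxEul ?block_mxEur ?block_mxEdl ?block_mxEdr !mxE -?val_eqE //=.
    + by rewrite !ord1.
    + by rewrite !ord1.
    + by rewrite !ord1.
  apply: mxlim_ext (mxlim_block (_ : mxlim +oo (fun X =>
      (X^-1 ^+ n.+1 * (step_pi (x X) n.+1)%:~R)%:M) _)
      (@mxlim_step_row n (r 0%N) _ _ S0) (lim_cst m 1 0) PP) => [X|].
    rewrite (@map_block_mx _ _ _ 1 m 1 m) (@scale_block_mx _ 1 m 1 m) map_scalar_mx scale_scalar_mx.
    by rewrite map_mx0 scaler0 map_mxM.
  move=> i j; rewrite !ord1 [X in _ --> X]mxE eqxx mulr1n.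
  apply: cvg_ext (@cvg_inv_prod (r 0%N) 0 n.+1) => X.
  by rewrite mxE eqxx mulr1n subn0.
- rewrite -(col_mx0 R 1 m).
  apply: mxlim_ext (mxlim_col (@mxlim_step_row n (r 0%N) _ _ U0) Q0) => X.
  by rewrite (@map_col_mx _ _ _ 1 m) (@scale_col_mx _ 1 m) map_mxM.
- split.
    rewrite -(row_mx0 R n.+1 1 m) -[X in row_mx X _]oppr0 -[X in row_mx _ X]oppr0.
    apply: mxlim_ext (mxlim_row (mxlimN (@mxlim_step_col n (r 0%N)))
        (mxlimN (@mxlim_step_tri n (r 0%N) _ _ S0))) => X.
    by rewrite (@map_row_mx _ _ _ _ 1 m) (@mul_mx_row _ _ _ 1 m) !map_mxN map_mxM !mulmxN.
  rewrite -oppr0; apply: mxlim_ext (mxlimN (@mxlim_step_tri n (r 0%N) _ _ U0)) => X.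
  by rewrite map_mxN map_mxM mulmxN.
Qed.
End CompanionLimits.

(** * From diagonal limits to arbitrary limits, by the Smith normal form *)

Lemma unitz_norm (u : int) : u \is a GRing.unit -> `|u| = 1.
Proof. by case/orP => /eqP ->. Qed.

Section IntegerMatrices.
Context (R : realType).
Local Notation zmx := (map_mx (intr : int -> R)).

Lemma norm_det_zmx n (L : 'M[int]_n) : L \in unitmx -> `|\det (zmx L)| = 1.
Proof. by rewrite unitmxE det_map_mx => /unitz_norm Lu; rewrite -intr_norm Lu. Qed.

Lemma zmx_unit n (L : 'M[int]_n) : L \in unitmx -> zmx L \in unitmx.
Proof. by move=> /norm_det_zmx L1; rewrite unitmxE unitfE -normr_eq0 L1 oner_eq0. Qed.

Lemma zmx_inv n (L : 'M[int]_n) : L \in unitmx -> zmx (invmx L) = invmx (zmx L).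
Proof.
move=> Lu; rewrite -[LHS]mulmx1 -(mulmxV (zmx_unit Lu)) mulmxA -map_mxM.
by rewrite mulVmx// map_mx1 mul1mx.
Qed.

(* In [unimodular_family], [a] and [b] are limits of rescaled complementary blocks of
   a unimodular matrix and of its inverse; complementary minors of the two agree up to
   sign, whence the condition on the determinants. *)
Definition tied_diagonals m n (a : 'M[R]_m) (b : 'M[R]_n) : Prop :=
  exists L1 R1 : 'M[int]_m, exists L2 R2 : 'M[int]_n, exists d1 d2,
  [/\ [/\ L1 \in unitmx, R1 \in unitmx, L2 \in unitmx & R2 \in unitmx],
      a = zmx L1 *m diag_mx d1 *m zmx R1,
      b = zmx L2 *m diag_mx d2 *m zmx R2 &
      `|\prod_i d1 0 i| = `|\prod_j d2 0 j| /\ \prod_i d1 0 i != 0].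

(** Put 1 outside the first row and column, copy t_j and s_i along these, and fix the corner by the
    product of the first row; equality of the total products then settles the first column. *)
Lemma prescribed_margins m n (s t : nat -> R) :
  \prod_(0 <= i < m.+1) s i = \prod_(0 <= j < n.+1) t j ->
  \prod_(0 <= i < m.+1) s i != 0 ->
  exists r : nat -> nat -> R,
    (forall i, (i < m.+1)%N -> \prod_(0 <= j < n.+1) r i j = s i) /\
    (forall j, (j < n.+1)%N -> \prod_(0 <= i < m.+1) r i j = t j).
Proof.
rewrite !big_nat_recl// => st.
rewrite st mulf_eq0 negb_or => /andP[t0 tP].
pose r i j := if i == 0%N then
    if j == 0%N then s 0%N / \prod_(0 <= j < n) t j.+1 else t j
  else if j == 0%N then s i else 1.
exists r; split=> [[_|i im]|[_|j jn]]; rewrite big_nat_recl// /r /=.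
- by rewrite divfK.
- by rewrite big1 ?mulr1.
- by rewrite mulrAC st mulfK.
- by rewrite big1 ?mulr1.
Qed.

(** Round X a and X b to integers and take Smith normal forms. Rounding spoils the equality of the
    determinants, so the approximation of [b] is rescaled by [theta], the (n+1)-th root of their
    ratio, which tends to 1. *)
Lemma tied_diagonals_approx m n (a : 'M[R]_m.+1) (b : 'M[R]_n.+1) :
  `|\det a| = `|\det b| -> \det a != 0 ->
  exists (f : R -> 'M[R]_m.+1) (g : R -> 'M[R]_n.+1),
  [/\ mxlim +oo f a, mxlim +oo g b &
      \forall X \near (+oo : set_system R), tied_diagonals (f X) (g X)].
Proof.
move=> ab a0; have b0 : \det b != 0 by rewrite -normr_eq0 -ab normr_eq0.
pose fl k (c : 'M[R]_k) (X : R) : 'M[int]_k := \matrix_(i, j) Num.floor (X * c i j).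
have flc k (c : 'M[R]_k) : mxlim +oo (fun X => X^-1 *: zmx (fl k c X)) c.
  by move=> i j; apply: cvg_ext (@cvg_floor_ratio R (c i j)) => X; rewrite !mxE.
pose f X := X^-1 *: zmx (fl _ a X); pose g X := X^-1 *: zmx (fl _ b X).
pose rho X := `|\det (f X)| / `|\det (g X)|.
have rho1 : rho X @[X --> (+oo : set_system R)] --> (1 : R).
  rewrite -[X in _ --> X](@divff _ `|\det a|) ?normr_eq0//.
  apply: cvgM; first exact: (cvg_norm (cvg_det (flc _ a))).
  rewrite ab; apply: cvgV; first by rewrite normr_eq0.
  exact: (cvg_norm (cvg_det (flc _ b))).
pose theta X := expR (n.+1%:R^-1 * ln (rho X)).
have theta1 : theta X @[X --> (+oo : set_system R)] --> (1 : R).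
  have <- : expR (n.+1%:R^-1 * ln 1) = 1 :> R by rewrite ln1 mulr0 expR0.
  have lnrho : ln (rho X) @[X --> (+oo : set_system R)] --> ln (1 : R).
    by apply: (cvg_comp _ _ rho1); exact: continuous_ln.
  apply: (cvg_comp _ _ (cvgM (cvg_cst (n.+1%:R^-1 : R)) lnrho)).
  exact: continuous_expR.
exists f, (fun X => theta X *: g X); split; first exact: flc.
  by rewrite -(scale1r b); apply: mxlimZ => //; exact: flc.
near=> X.
have X0 : X^-1 != 0.
  by rewrite invr_eq0 gt_eqF//; near: X; exact: nbhs_pinfty_gt.
have fX0 : \det (f X) != 0 by near: X; apply: near_det_neq0 a0; exact: flc.
have gX0 : \det (g X) != 0 by near: X; apply: near_det_neq0 b0; exact: flc.
have [L1 L1u [R1 R1u [d1 _ E1]]] := int_Smith_normal_form (fl _ a X).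
have [L2 L2u [R2 R2u [d2 _ E2]]] := int_Smith_normal_form (fl _ b X).
have smith k (M L K : 'M[int]_k) (d : seq int) c :
    M = L *m \matrix_(i, j) (d`_i *+ (i == j :> nat)) *m K ->
    c *: zmx M = zmx L *m diag_mx (\row_i (c * (d`_i)%:~R)) *m zmx K.
  move=> ->; rewrite !map_mxM scalemxAl scalemxAr; congr (_ *m _ *m _).
  by apply/matrixP => i j; rewrite !mxE rmorphMn /= mulrnAr.
have fE := smith _ _ _ _ _ X^-1 E1.
have gE := smith _ _ _ _ _ (theta X * X^-1) E2.
exists L1, R1, L2, R2, (\row_i (X^-1 * (d1`_i)%:~R)),
  (\row_i (theta X * X^-1 * (d2`_i)%:~R)).
have detf : `|\det (f X)| = `|\prod_i (\row_i (X^-1 * (d1`_i)%:~R) : 'rV[R]_m.+1) 0 i|.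
  by rewrite /f fE !det_mulmx det_diag !normrM !norm_det_zmx// mulr1 mul1r.
split=> //; first by rewrite /g scalerA gE.
split; last by rewrite -normr_eq0 -detf normr_eq0.
rewrite -detf.
have -> : `|\prod_j (\row_i (theta X * X^-1 * (d2`_i)%:~R) : 'rV[R]_n.+1) 0 j| =
    `|\det (theta X *: g X)|.
  by rewrite /g scalerA gE !det_mulmx det_diag !normrM !norm_det_zmx// mulr1 mul1r.
have thetan : theta X ^+ n.+1 = rho X.
  rewrite -[LHS]expRM_natl mulrA mulfV ?pnatr_eq0// mul1r lnK// posrE.
  by rewrite divr_gt0 ?normr_gt0.
rewrite (detZ (theta X)) (normrM (theta X ^+ _)) thetan (ger0_norm (_ : 0 <= rho X)) ?divr_ge0 ?normr_ge0//.
by rewrite divfK ?normr_eq0.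
Unshelve. all: by end_near. Qed.

(** Take the companion family whose row products are [d1] and column products [d2]. Multiplying it
    by diag(L1, R2^-1) on the left and diag(R1, L2^-1) on the right turns the limit of [P] into [a],
    and that of [D], in the inverse, into [b]. *)
Lemma unimodular_family m n (a : 'M[R]_m.+1) (b : 'M[R]_n.+1) :
  tied_diagonals a b ->
  exists G : R -> 'M[int]_(m.+1 + n.+1),
  [/\ forall X, G X \in unitmx,
      mxlim +oo (fun X => X^-1 ^+ n.+1 *: zmx (G X)) (block_mx a 0 0 0) &
      mxlim +oo (fun X => X^-1 ^+ m.+1 *: invmx (zmx (G X))) (block_mx 0 0 0 b)].
Proof.
move=> [L1 [R1 [L2 [R2 [d1 [d2 [[L1u R1u L2u R2u] -> -> [d12 d10]]]]]]]].
(* The two products agree only up to sign; the sign is moved from the first entry of [d2] into the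
   unimodular factor [L2]. *)
wlog d12E : L2 L2u d2 d12 / \prod_i d1 0 i = \prod_j d2 0 j.
  move=> W; pose e : R := \prod_i d1 0 i / \prod_j d2 0 j.
  have d20 : \prod_j d2 0 j != 0 by rewrite -normr_eq0 -d12 normr_eq0.
  have e1 : `|e| = 1 by rewrite normrM normfV d12 mulfV ?normr_eq0.
  have [z ez z2] : exists2 z : int, e = z%:~R & z * z = 1.
    have [e0|e0] := ger0P e; first by exists 1; rewrite // -e1 ger0_norm.
    by exists (-1); rewrite // -[e]opprK -(ltr0_norm e0) e1.
  pose E : 'rV[int]_n.+1 := \row_j (if j == 0 then z else 1).
  have EE : diag_mx E *m diag_mx E = 1%:M.
    rewrite mulmx_diag -diag_const_mx; congr diag_mx; apply/rowP => j.
    by rewrite !mxE; case: ifP.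
  have Eu : diag_mx E \in unitmx by case: (mulmx1_unit EE).
  pose d3 : 'rV[R]_n.+1 := \row_j ((E 0 j)%:~R * d2 0 j).
  have E3 : zmx L2 *m diag_mx d2 = zmx (L2 *m diag_mx E) *m diag_mx d3.
    rewrite map_mxM -mulmxA; congr (_ *m _).
    rewrite map_diag_mx mulmx_diag; congr diag_mx; apply/rowP => j.
    rewrite !mxE mulrA -intrM; case: ifP => _; last by rewrite mulr1 mul1r.
    by rewrite z2 mul1r.
  have d3E : \prod_i d1 0 i = \prod_j d3 0 j.
    rewrite [RHS](eq_bigr (fun j => (E 0 j)%:~R * d2 0 j)) => [|j _]; last by rewrite !mxE.
    rewrite big_split /= [X in X * _](_ : _ = e) ?divfK//.
    rewrite big_ord_recl mxE eqxx -ez big1 ?mulr1// => j _.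
    by rewrite mxE.
  rewrite E3; apply: W; rewrite ?unitmx_mul ?L2u//.
  by rewrite -d3E.
pose s i := d1 0 (inord i : 'I_m.+1); pose t j := d2 0 (inord j : 'I_n.+1).
have sE : \prod_(0 <= i < m.+1) s i = \prod_i d1 0 i.
  by rewrite big_mkord; apply: eq_bigr => i _; rewrite /s inord_val.
have tE : \prod_(0 <= i < n.+1) t i = \prod_i d2 0 i.
  by rewrite big_mkord; apply: eq_bigr => i _; rewrite /t inord_val.
have [||r [rs rt]] := @prescribed_margins m n s t; rewrite ?sE ?tE//.
have [A [B [C [D [P [Q [S [U]]]]]]]] := companion_family m.+1 n r.
move=> [ABCD [A0 B0 C0 DD] PP Q0 [S0 U0]].
have {}DD : mxlim +oo (fun X => X^-1 ^+ m.+1 *: zmx (D X)) (diag_mx d2).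
  have <- : \row_j \prod_(0 <= i < m.+1) r i j = d2 by
    apply/rowP => j; rewrite mxE rt// /t inord_val.
  exact: DD.
have {}PP : mxlim +oo (fun X => X^-1 ^+ n.+1 *: zmx (P X)) (diag_mx d1).
  have <- : \row_i \prod_(0 <= j < n.+1) r i j = d1 by
    apply/rowP => i; rewrite mxE rs// /s inord_val.
  exact: PP.
(* Row j is o(X^(j+1)) with j+1 at most n+1, so the graded bound implies the uniform bound
   o(X^(n+1)). *)
have row0 p (V : R -> 'M[R]_(n.+1, p)) :
    mxlim +oo (fun X => powers_mx _ X^-1 *m V X) 0 ->
    mxlim +oo (fun X => X^-1 ^+ n.+1 *: V X) 0.
  move=> V0 j k; rewrite [X in _ --> X]mxE.
  have cj : X^-1 ^+ (n.+1 - j.+1) @[X --> (+oo : set_system R)] -->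
      ((n.+1 - j.+1 == 0)%N%:R : R).
    case: (n.+1 - j.+1)%N => [|l]; first exact: cvg_cst.
    by apply: cvg_ext (cvg_inv_exp_0 l (cvg_cst (1 : R))) => X; rewrite mulr1.
  rewrite -(mulr0 (n.+1 - j.+1 == 0)%N%:R).
  have V0jk : (powers_mx _ X^-1 *m V X) j k @[X --> (+oo : set_system R)] --> (0 : R).
    by have := V0 j k; rewrite [X in _ --> X -> _]mxE.
  apply: cvg_ext (cvgM cj V0jk) => X.
  by rewrite mul_diag_mx !mxE /= mulrA -exprD subnK.
exists (fun X => block_mx L1 0 0 (invmx R2) *m block_mx (P X) (Q X) (S X) (U X)
    *m block_mx R1 0 0 (invmx L2)).
pose H X := block_mx (invmx R1) 0 0 L2 *m block_mx (A X) (B X) (C X) (D X)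
    *m block_mx (invmx L1) 0 0 R2.
have HG X : H X *m (block_mx L1 0 0 (invmx R2) *m block_mx (P X) (Q X) (S X) (U X)
    *m block_mx R1 0 0 (invmx L2)) = 1%:M.
  rewrite /H -!mulmxA (mulmxA (block_mx (invmx L1) _ _ _)) mulmx_block.
  rewrite !(mul0mx, mulmx0, addr0, add0r) mulVmx// mulmxV// -scalar_mx_block mul1mx.
  rewrite (mulmxA (block_mx (A X) _ _ _)) ABCD mul1mx mulmx_block.
  by rewrite !(mul0mx, mulmx0, addr0, add0r) mulVmx// mulmxV// -scalar_mx_block.
split=> [X||].
- by case: (mulmx1_unit (HG X)).
- have -> : block_mx (zmx L1 *m diag_mx d1 *m zmx R1) 0 0 0 =
      block_mx (zmx L1) 0 0 (zmx (invmx R2)) *m block_mx (diag_mx d1) 0 0 0 *m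
      block_mx (zmx R1) 0 0 (zmx (invmx L2)) :> 'M[R]_(m.+1 + n.+1).
    by rewrite !mulmx_block !(mul0mx, mulmx0, addr0).
  apply: mxlim_ext (mxlimM (mxlimM (mxlim_cst (block_mx (zmx L1) 0 0 (zmx (invmx R2))))
    (mxlim_block PP Q0 (row0 _ _ S0) (row0 _ _ U0)))
    (mxlim_cst (block_mx (zmx R1) 0 0 (zmx (invmx L2))))) => X.
  by rewrite !map_mxM !map_block_mx !map_mx0 -scale_block_mx scalemxAl scalemxAr.
- have -> : block_mx 0 0 0 (zmx L2 *m diag_mx d2 *m zmx R2) =
      block_mx (zmx (invmx R1)) 0 0 (zmx L2) *m block_mx 0 0 0 (diag_mx d2) *m
      block_mx (zmx (invmx L1)) 0 0 (zmx R2) :> 'M[R]_(m.+1 + n.+1).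
    by rewrite !mulmx_block !(mul0mx, mulmx0, addr0, add0r).
  apply: mxlim_ext (mxlimM (mxlimM (mxlim_cst (block_mx (zmx (invmx R1)) 0 0 (zmx L2)))
    (mxlim_block A0 B0 C0 DD)) (mxlim_cst (block_mx (zmx (invmx L1)) 0 0 (zmx R2)))) => X.
  have -> : invmx (zmx (block_mx L1 0 0 (invmx R2) *m block_mx (P X) (Q X) (S X) (U X)
    *m block_mx R1 0 0 (invmx L2))) = zmx (H X).
    set G := block_mx L1 _ _ _ *m _ *m _.
    have HGX : H X *m G = 1%:M := HG X.
    have Gu : G \in unitmx by case: (mulmx1_unit HGX).
    by rewrite -zmx_inv//; congr zmx; rewrite -[LHS]mul1mx -HGX mulmxK.
  by rewrite !map_mxM !map_block_mx !map_mx0 -scale_block_mx scalemxAl scalemxAr.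
Qed.
End IntegerMatrices.

(** * Mahler's compactness criterion *)

Section Reduction.
Context (R : realType).
Local Notation zmx := (map_mx (intr : int -> R)).

Lemma mx_norm_entry m n (A : 'M[R]_(m, n)) i j : `|A i j| <= `|A|.
Proof.
rewrite [leRHS]/Num.norm /= mx_normrE.
by apply/bigmax_geP; right => /=; exists (i, j).
Qed.

Lemma mx_norm_le m n (A : 'M[R]_(m, n)) K : 0 <= K ->
  (forall i j, `|A i j| <= K) -> `|A| <= K.
Proof.
move=> K0 AK; rewrite [leLHS]/Num.norm /= mx_normrE.
by apply/bigmax_leP; split => // -[i j] _; exact: AK.
Qed.

Lemma mx_norm_attained m n (A : 'M[R]_(m, n)) : A != 0 ->
  exists i j, `|A| = `|A i j|.
Proof.
move=> A0; have /mx_norm_neq0[[i j] Aij] : mx_norm A != 0 by rewrite -[mx_norm A]/`|A| normr_eq0.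
by exists i, j.
Qed.

Lemma round_half (x : R) : exists k : int, `|k%:~R + x| <= 2^-1.
Proof.
exists (- Num.floor (x + 2^-1)); rewrite rmorphN /= ler_norml.
have := floor_le (x + 2^-1); have := floorD1_gt (x + 2^-1); rewrite intrD.
by move: (_%:~R) => y; lra.
Qed.

Definition lattice_min d (h : 'M[R]_d) (e : R) : Prop :=
  forall z : 'cV[int]_d, z != 0 -> e <= `|h *m zmx z|.

Lemma norm_le_xrow m n (A : 'M[R]_(m, n)) i k : `|A| <= `|xrow i k A|.
Proof.
apply: mx_norm_le => // a b.
have -> : A a b = xrow i k A (tperm i k a) b by rewrite mxE tpermK.
exact: mx_norm_entry.
Qed.

(* One step of Gram-Schmidt for the sup norm: a column of (almost) minimal norm is
   eliminated along its largest entry, rounding makes the other columns short. *)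
Lemma lattice_reduction d (h : 'M[R]_d.+1) (e : R) : 0 < e -> \det h != 0 ->
  lattice_min h e ->
  exists (l : R) (h' : 'M[R]_d),
  [/\ e <= l, lattice_min h (4 / 5 * l), `|\det h| = l * `|\det h'|,
      lattice_min h' (3 / 10 * l) &
      forall (g' : 'M[int]_d) (K : R), g' \in unitmx -> 0 <= K ->
        (forall i j, `|(h' *m zmx g') i j| <= K) ->
      exists2 g : 'M[int]_d.+1, g \in unitmx &
        forall i j, `|(h *m zmx g) i j| <= K + l].
Proof.
move=> e0 h0 he.
pose N : set R := [set `|h *m zmx z| | z in [set z : 'cV[int]_d.+1 | z != 0]].
have N0 : N !=set0.
  exists `|h *m zmx (delta_mx 0 0 : 'cV[int]_d.+1)|; exists (delta_mx 0 0 : 'cV[int]_d.+1) => //=.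
  by apply/negP => /eqP/matrixP/(_ 0 0); rewrite !mxE !eqxx.
have Ne : lbound N e by move=> _ [z z0 <-]; exact: he.
have e_inf : e <= inf N by exact: lb_le_inf.
have inf0 : 0 < inf N by exact: lt_le_trans e_inf.
(* No minimal vector is needed: a norm l below 5/4 of the infimum makes every nonzero vector of norm
   at least 4/5 l. *)
have [_ [z0 z00 <-] z0N] : exists2 x, N x & x < inf N + inf N / 4.
  by apply: inf_adherent; [rewrite divr_gt0|split => //; exists e].
set l := `|h *m zmx z0| in z0N.
have el : e <= l by exact: he.
have l0 : 0 < l by exact: lt_le_trans el.
have hl : lattice_min h (4 / 5 * l).
  move=> z zn0; have : inf N <= `|h *m zmx z| by apply: ge_inf; [exists e|exists z].
  by move: z0N inf0; move: (inf N) (`|h *m _|) => a b; lra.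
(* The Smith form of a single column writes [z0] as an integer multiple of [z1], the first column of
   a unimodular matrix. *)
have [L Lu [Q _ [s _ z0E]]] := int_Smith_normal_form z0.
pose z1 := col 0 L; pose g : int := s`_0 * Q 0 0.
have z0g : z0 = g *: z1.
  rewrite z0E; apply/matrixP => i j; rewrite !mxE big_ord1 !ord1 mxE big_ord_recl.
  rewrite big1 => [|k _]; first by rewrite !mxE /= addr0 mulr1n /g; ring.
  by rewrite !mxE /= mulr0n mulr0.
have lg : l = `|g|%:~R * `|h *m zmx z1|.
  by rewrite /l z0g map_mxZ -scalemxAr normrZ intr_norm.
(* A multiple |g| >= 2 would give [z1] a norm at most l/2, below 4/5 l; hence |g| = 1 and [z1] also
   has norm l. *)
have z10 : z1 != 0 by apply: contraNneq z00 => z1E; rewrite z0g z1E scaler0.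
have hz1 : `|h *m zmx z1| = l.
  have := hl _ z10; rewrite lg => z1l.
  have g0 : `|g| != 0 by apply: contraTneq l0; rewrite lg => ->; rewrite mul0r ltxx.
  have : `|g|%N = 1%N.
    apply/eqP; rewrite eqn_leq absz_gt0 -normr_eq0 g0 andbT leqNgt; apply/negP => g2.
    have : (2 : R) <= `|g|%:~R by rewrite -[2]/(2%:~R) ler_int -abszE lez_nat.
    by move: l0 hl => l0 _; move: z1l l0; rewrite lg; move: (`|h *m _|) (_%:~R) => a b; nra.
  by rewrite -abszE => ->; rewrite mul1r.
have [H HE] : exists H, H = h *m zmx L by exists (h *m zmx L).
have colH : col 0 H = h *m zmx z1.
  by rewrite HE; apply/matrixP => i j; rewrite !mxE; apply: eq_bigr => k _; rewrite !mxE.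
have col0 i : `|H i 0| <= l.
  have -> : H i 0 = col 0 H i 0 by rewrite [RHS]mxE.
  by rewrite -hz1 -colH; exact: mx_norm_entry.
have [i0 wl] : exists i, `|H i 0| = l.
  have [|i [j ij]] := @mx_norm_attained _ _ (col 0 H).
    by rewrite -normr_eq0 colH hz1 gt_eqF.
  by exists i; rewrite -hz1 -colH ij [col _ _ _ _]mxE.
(* The swap moves the largest entry of the first column to the pivot [w], with |w| = l; [h'] below
   is the Schur complement of this pivot. *)
pose H2 : 'M[R]_(1 + d) := xrow i0 0 H; pose w := H i0 0.
have w0 : w != 0 by rewrite -normr_eq0 wl gt_eqF.
pose dl := dlsubmx H2; pose ur := ursubmx H2.
have H2E : H2 = block_mx w%:M ur dl (drsubmx H2).
  rewrite -[LHS]submxK; congr block_mx; apply/matrixP => i j.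
  rewrite !ord1 [RHS]mxE eqxx mulr1n !mxE /w; congr (H _ _); last exact: val_inj.
  by rewrite -[RHS](tpermR i0 0); congr (tperm _ _ _); exact: val_inj.
have dll i : `|dl i 0| <= l.
  rewrite !mxE (_ : lshift d 0 = 0); first exact: col0.
  exact: val_inj.
pose h' := drsubmx H2 - w^-1 *: (dl *m ur).
(* Integer multiples of the first column reduce the pivot row of any integer combination to [w]
   times coefficients of size at most 1/2. *)
have key p (M : 'M[int]_(d, p)) : exists (k : 'M[int]_(1, p)) (t : 'M[R]_(1, p)),
    (forall j, `|t 0 j| <= 2^-1) /\
    H2 *m zmx (col_mx k M) = col_mx (w *: t) (h' *m zmx M + dl *m t).
  have /choice[k kP] := fun j => round_half ((w^-1 *: (ur *m zmx M)) 0 j).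
  exists (\row_j k j), (zmx (\row_j k j) + w^-1 *: (ur *m zmx M)); split.
    by move=> j; have := kP j; rewrite !mxE.
  rewrite map_col_mx {1}H2E mul_block_col mul_scalar_mx; congr col_mx.
    by rewrite scalerDr scalerA mulfV// scale1r.
  rewrite mulmxDr /h' mulmxBl -!scalemxAr -scalemxAl mulmxA.
  by rewrite addrACA addrC addrA [- _ + _ + _]addrC addrA addrNK addrC.
have hg p (v : 'M[int]_(d.+1, p)) : xrow i0 0 (h *m zmx (L *m v)) = H2 *m zmx v.
  by rewrite map_mxM mulmxA -HE xrowE mulmxA -xrowE.
exists l, h'; split => //.
- rewrite -[LHS]mulr1 -(norm_det_zmx R Lu) -normrM -det_mulmx -HE.
  have -> : `|\det H| = `|\det H2|.
    by rewrite /H2 xrowE det_mulmx det_perm normrM normrX normrN1 expr1n mul1r.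
  rewrite -wl -normrM; congr `|_|.
  have -> : H2 = block_mx 1%:M 0 (w^-1 *: dl) 1%:M *m block_mx w%:M ur 0 h'.
    rewrite mulmx_block !(mul0mx, mulmx0, addr0, add0r, mul1mx) {1}H2E; congr block_mx.
      by rewrite -scalemxAl mul_mx_scalar scalerA mulVf// scale1r.
    by rewrite -scalemxAl addrC subrK.
  by rewrite det_mulmx det_lblock det_ublock !det1 det_scalar1 !mul1r.
- move=> z zn0; have [k [t [t2 E]]] := key _ z.
  have kz0 : L *m col_mx k z != 0.
    apply: contraNneq zn0 => /(congr1 (mulmx (invmx L))); rewrite mulKmx// mulmx0.
    by move=> /(congr1 (@dsubmx _ 1 d 1)); rewrite col_mxKd linear0 => ->.
  (* The vector has norm at least 4/5 l and at most |h' z| + l/2, which leaves 3/10 l for |h' z|. *)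
  have := le_trans (hl _ kz0) (norm_le_xrow _ i0 0); rewrite hg E => le1.
  have : `|col_mx (w *: t) (h' *m zmx z + dl *m t)| <= `|h' *m zmx z| + l / 2.
    apply: mx_norm_le => [|i j]; first by rewrite addr_ge0// divr_ge0// ltW.
    rewrite !ord1; case: (split_ordP i) => i' ->; rewrite ?col_mxEu ?col_mxEd.
      rewrite !ord1 mxE normrM wl (le_trans (ler_wpM2l (ltW l0) (t2 0)))//.
      by rewrite lerDr.
    rewrite mxE (le_trans (ler_normD _ _))// lerD ?mx_norm_entry//.
    by rewrite mxE big_ord1 normrM ler_pM.
  by move: le1; move: (`|col_mx _ _|) (`|h' *m _|) => a b; lra.
- move=> g' K g'u K0 g'K; have [k [t [t2 E]]] := key _ g'.
  pose G : 'M[int]_(1 + d) := block_mx 1%:M k 0 g'.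
  have Gu : L *m G \in unitmx.
    by rewrite unitmx_mul Lu unitmxE (@det_ublock _ 1 d) det1 mul1r -unitmxE.
  exists (L *m G) => // i j.
  apply: le_trans (mx_norm_entry _ i j) (le_trans (norm_le_xrow _ i0 0) _).
  rewrite hg /G block_mxEh (@map_row_mx _ _ _ (1 + d) 1 d) (@mul_mx_row _ _ _ 1 d) E.
  rewrite (@map_col_mx _ _ _ 1 d) map_mx1 map_mx0 H2E mul_block_col !mulmx1 !mulmx0 !addr0.
  apply: mx_norm_le => [|a b]; first exact: addr_ge0 (ltW l0).
  case: (split_ordP (b : 'I_(1 + d))) => b' ->; rewrite ?(@row_mxEl _ (1 + d) 1 d) ?(@row_mxEr _ (1 + d) 1 d);
  case: (split_ordP (a : 'I_(1 + d))) => a' ->; rewrite ?(@col_mxEu _ 1 d) ?(@col_mxEd _ 1 d).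
  - by rewrite !ord1 mxE eqxx mulr1n -/w wl lerDr.
  - by rewrite !ord1 (le_trans (dll _))// lerDr.
  - rewrite !ord1 mxE normrM wl (le_trans (ler_wpM2l (ltW l0) (t2 _)))//.
    by move: l0 K0; lra.
  - rewrite mxE (le_trans (ler_normD _ _))// lerD//.
    rewrite mxE big_ord1 normrM (le_trans (ler_pM _ _ (dll _) (t2 _)))//.
    by move: l0; lra.
Qed.
End Reduction.

(** * Uniform bounds from iterated reduction *)

Section Mahler.
Context (R : realType).
Local Notation zmx := (map_mx (intr : int -> R)).

(** Each reduction splits off a factor l >= e of the determinant and lowers the minimum to no less
    than 3/10 l, whence the power of 3/10 in the constant. *)
Lemma minkowski_bound d : exists2 c : R, 0 < c &
  forall (h : 'M[R]_d) e, 0 < e -> \det h != 0 -> lattice_min h e ->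
    c * e ^+ d <= `|\det h|.
Proof.
elim: d => [|d [c c0 IH]].
  by exists 1 => // h e _ _ _; rewrite det_mx00 expr0 mulr1 normr1.
exists (c * (3 / 10) ^+ d); first by rewrite mulr_gt0// exprn_gt0// divr_gt0.
move=> h e e0 h0 he; have [l [h' [el _ detE h'l _]]] := lattice_reduction e0 h0 he.
have l0 : 0 < l := lt_le_trans e0 el.
have h'0 : \det h' != 0.
  by apply: contraNneq h0 => h'0; rewrite -normr_eq0 detE h'0 normr0 mulr0.
have l'0 : 0 < 3 / 10 * l by rewrite mulr_gt0// divr_gt0.
rewrite detE exprS mulrCA ler_pM//; first exact: ltW.
  by rewrite mulr_ge0 ?exprn_ge0 ?mulr_ge0 ?ltW// exprn_gt0// divr_gt0.
apply: le_trans (IH h' _ l'0 h'0 h'l); rewrite -(mulrA c) ler_pM2l// -exprMn.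
by apply: lerXn2r; rewrite ?nnegrE; move: el e0 l0; lra.
Qed.

(** After one reduction the determinant is at most D / e and the minimum at least 3/10 e, so
    induction applies to [h']; lifting the basis back costs l, which [minkowski_bound] controls. *)
Lemma mahler_compactness d (e D : R) : 0 < e -> exists2 K : R, 0 <= K &
  forall h : 'M[R]_d, \det h != 0 -> `|\det h| <= D -> lattice_min h e ->
  exists2 g : 'M[int]_d, g \in unitmx & forall i j, `|(h *m zmx g) i j| <= K.
Proof.
elim: d e D => [|d IH] e D e0.
  by exists 0 => // h _ _ _; exists 1%:M; [exact: unitmx1|case].
have [c c0 mink] := minkowski_bound d.+1.
have e'0 : 0 < 3 / 10 * e by rewrite mulr_gt0// divr_gt0.
have [K K0 IHK] := IH (3 / 10 * e) (D / e) e'0.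
(* If l > 1 then l <= l^(d+1), and the lower bound on the determinant, with minimum 4/5 l, gives the
   second term. *)
pose B := Num.max 1 (D / (c * (4 / 5) ^+ d.+1)).
have c'0 : 0 < c * (4 / 5) ^+ d.+1 by rewrite mulr_gt0// exprn_gt0// divr_gt0.
exists (K + B) => [|h h0 hD he]; first by rewrite addr_ge0// le_max ler01.
have [l [h' [el hl detE h'l lift]]] := lattice_reduction e0 h0 he.
have l0 : 0 < l := lt_le_trans e0 el.
have h'0 : \det h' != 0.
  by apply: contraNneq h0 => h'0; rewrite -normr_eq0 detE h'0 normr0 mulr0.
have lB : l <= B.
  rewrite le_max; have [//|/ltW l1 /=] := leP l 1.
  rewrite ler_pdivlMr// mulrC; apply: le_trans (le_trans (mink h _ _ h0 hl) hD).
    rewrite [(4 / 5 * l) ^+ _]exprMn mulrA ler_pM2l//.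
    by rewrite exprS ler_peMr ?exprn_ege1// ltW.
  by rewrite mulr_gt0// divr_gt0.
have [g' g'u g'K] : exists2 g : 'M[int]_d, g \in unitmx &
    forall i j, `|(h' *m zmx g) i j| <= K.
  apply: IHK => //.
    rewrite ler_pdivlMr// mulrC; apply: le_trans hD; rewrite detE.
    by rewrite ler_wpM2r.
  by move=> z z0; apply: le_trans (h'l z z0); move: el; lra.
have [g gu gK] := lift g' K g'u K0 g'K.
by exists g => // i j; rewrite (le_trans (gK i j))// lerD2l.
Qed.

(** From P k^T = L U, the matrix k P^-1 is the transpose of L U, whose upper left block is the
    product of those of L and U. Reduction modulo [lower_mx] requires such an invertible block. *)
Lemma invertible_corner m n (k : 'M[R]_(m.+1 + n)) : \det k != 0 ->
  exists2 a : 'M[int]_(m.+1 + n), a \in unitmx &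
    \det (ulsubmx (k *m zmx a)) != 0.
Proof.
move=> k0; have := @cormen_lup_correct R (m + n) k^T.
have := @cormen_lup_perm R (m + n) k^T; have := @cormen_lup_detL R (m + n) k^T.
have := @cormen_lup_lower R (m + n) k^T; have := @cormen_lup_upper R (m + n) k^T.
case: (cormen_lup _) => [[P L] U] /= Uup Llow L1 /is_perm_mxP[s ->] PLU.
pose L' : 'M[R]_(m.+1 + n) := L; pose U' : 'M[R]_(m.+1 + n) := U.
exists (perm_mx s^-1); first exact: unitmx_perm.
have U0 : \det U' != 0.
  have /(congr1 determinant) := PLU; rewrite -!mulmxE !det_mulmx L1 mul1r => <-.
  by rewrite det_perm det_tr mulf_neq0// expf_neq0// oppr_eq0 oner_eq0.
have U21 : dlsubmx U' = 0.
  apply/matrixP => i j; rewrite !mxE; apply: Uup => /=.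
  by rewrite ltn_addr.
have L12 : ursubmx L' = 0.
  apply/matrixP => i j; rewrite !mxE Llow /=; last by rewrite ltnW// ltn_addr.
  by rewrite -val_eqE /= ltn_eqF// ltn_addr.
have LUul : ulsubmx (L' *m U') = ulsubmx L' *m ulsubmx U'.
  rewrite -[L' in LHS]submxK -[U' in LHS]submxK mulmx_block block_mxKul L12.
  by rewrite mul0mx addr0.
have -> : k *m zmx (perm_mx s^-1) = (L' *m U')^T.
  rewrite -[L' *m U']/(L * U) -PLU -mulmxE trmx_mul trmxK tr_perm_mx map_perm_mx.
  by [].
have -> : ulsubmx (L' *m U')^T = (ulsubmx (L' *m U'))^T by rewrite trmx_ulsub.
rewrite det_tr LUul det_mulmx mulf_neq0//.
  have : \det L' != 0 by rewrite -[\det L']/(\det L) L1 oner_eq0.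
  rewrite -[L']submxK L12 det_lblock block_mxKul.
  by rewrite mulf_eq0 negb_or => /andP[].
by move: U0; rewrite -[U']submxK U21 det_ublock block_mxKul mulf_eq0 negb_or => /andP[].
Qed.
End Mahler.

(** * Density of the contracted horospherical orbit *)

Definition adherent (R : realType) m n (S : set 'M[R]_(m, n)) (A : 'M[R]_(m, n)) : Prop :=
  forall e, 0 < e -> exists2 B, S B & forall i j, `|A i j - B i j| < e.

Section Adherence.
Context (R : realType).

Lemma adherent_lim (T : Type) (F : set_system T) {PF : ProperFilter F} m n
    (S : set 'M[R]_(m, n)) (f : T -> 'M[R]_(m, n)) A :
  (\forall x \near F, adherent S (f x)) -> mxlim F f A -> adherent S A.
Proof.
move=> Sf fA e e0; have e20 : 0 < e / 2 by rewrite divr_gt0.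
have [x [Sfx fxA]] := filter_ex (filterI Sf (mxlim_dist e20 fA)).
have [B SB fB] := Sfx _ e20; exists B => // i j.
rewrite (le_lt_trans (ler_distD (f x i j) _ _))// [ltRHS]splitr ltrD//.
Qed.

Lemma adherent_self m n (S : set 'M[R]_(m, n)) A : S A -> adherent S A.
Proof. by move=> SA e e0; exists A => // i j; rewrite subrr normr0. Qed.

Lemma adherent_seq m n (S : set 'M[R]_(m, n)) A : adherent S A ->
  exists2 f : nat -> 'M[R]_(m, n), (forall k, S (f k)) & mxlim \oo f A.
Proof.
move=> SA; have inv0 k : 0 < k.+1%:R^-1 :> R by rewrite invr_gt0.
have /choice[f fP] : forall k, exists B, S B /\ forall i j, `|A i j - B i j| < k.+1%:R^-1.
  by move=> k; have [B SB AB] := SA _ (inv0 k); exists B.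
exists f => [k|i j]; first by case: (fP k).
apply/cvgrPdist_lt => e e0; near=> k.
have [_ /(_ i j) fk] := fP k; apply: lt_trans fk _.
near: k; exact: near_infty_natSinv_lt (PosNum e0).
Unshelve. all: by end_near. Qed.

Lemma adherent_mull m n p (M : 'M[R]_(p, m)) (S : set 'M[R]_(m, n)) (S' : set 'M[R]_(p, n)) A :
  (forall B, S B -> S' (M *m B)) -> adherent S A -> adherent S' (M *m A).
Proof.
move=> SM /adherent_seq[f fS fA]; apply: (adherent_lim _ (mxlimM (mxlim_cst M) fA)).
by apply: nearW => k; apply/adherent_self/SM.
Qed.

Lemma adherent_mulr m n p (M : 'M[R]_(n, p)) (S : set 'M[R]_(m, n)) (S' : set 'M[R]_(m, p)) A :
  (forall B, S B -> S' (B *m M)) -> adherent S A -> adherent S' (A *m M).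
Proof.
move=> SM /adherent_seq[f fS fA]; apply: (adherent_lim _ (mxlimM fA (mxlim_cst M))).
by apply: nearW => k; apply/adherent_self/SM.
Qed.
End Adherence.

(** * The lower unipotent group and complementary blocks *)

Section HorosphericalOrbit.
Context (R : realType) (m n : nat).
Local Notation zmx := (map_mx (intr : int -> R)).
Local Notation d := (m.+1 + n.+1)%N.
Implicit Types (h k : 'M[R]_d).

Definition lower_mx (c : 'M[R]_(n.+1, m.+1)) : 'M[R]_d := block_mx 1%:M 0 c 1%:M.

Lemma lower_mxM c c' : lower_mx c *m lower_mx c' = lower_mx (c + c').
Proof. by rewrite mulmx_block !(mul0mx, mulmx0, mul1mx, mulmx1, addr0, add0r). Qed.

(** All integral bases, of either orientation, of the lattices in the orbit of the lattice of [g]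
    under the contracted group. *)
Definition lower_orbit (g : 'M[R]_d) : set 'M[R]_d :=
  [set h | exists c (a : 'M[int]_d), a \in unitmx /\ h = lower_mx c *m g *m zmx a].

Lemma adherent_lower g h c :
  adherent (lower_orbit g) h -> adherent (lower_orbit g) (lower_mx c *m h).
Proof.
apply: adherent_mull => _ [c' [a [au ->]]]; exists (c + c'), a; split => //.
by rewrite -lower_mxM !mulmxA.
Qed.

Lemma adherent_zmx g h (a : 'M[int]_d) : a \in unitmx ->
  adherent (lower_orbit g) h -> adherent (lower_orbit g) (h *m zmx a).
Proof.
move=> au; apply: adherent_mulr => _ [c [a' [a'u ->]]]; exists c, (a' *m a).
by rewrite unitmx_mul a'u au map_mxM !mulmxA.
Qed.

Lemma g_flowM s t : g_flow m.+1 n.+1 s *m g_flow m.+1 n.+1 t = g_flow m.+1 n.+1 (s + t) :> 'M[R]_d.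
Proof.
rewrite /g_flow mulmx_block !(mul0mx, mulmx0, addr0, add0r) -!scalar_mxM -!expRD.
by rewrite -!mulrDl opprD.
Qed.

Lemma g_flow0 : g_flow m.+1 n.+1 0 = 1%:M :> 'M[R]_d.
Proof. by rewrite /g_flow oppr0 !mul0r expR0 -scalar_mx_block. Qed.

Lemma det_g_flow t : \det (g_flow m.+1 n.+1 t : 'M[R]_d) = 1.
Proof.
rewrite /g_flow det_ublock !det_scalar -!expRM_natl -expRD.
by rewrite mulrC divfK ?pnatr_eq0// mulrC divfK ?pnatr_eq0// subrr expR0.
Qed.

(** Complementary minors: with V = k^-1, the product of k and [[1, V12], [0, V22]] is [[k11, 0],
    [k21, 1]]. *)
Lemma det_ulsub_inv k : \det k != 0 ->
  \det (ulsubmx k) = \det k * \det (drsubmx (invmx k)).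
Proof.
move=> k0; have ku : k \in unitmx by rewrite unitmxE unitfE.
pose V := invmx k; have := mulmxV ku; rewrite -/V.
rewrite -{1}(submxK k) -{1}(submxK V) mulmx_block [X in _ = X]scalar_mx_block.
move=> /eq_block_mx[_ E12 _ E22].
transitivity (\det (k *m block_mx 1%:M (ursubmx V) 0 (drsubmx V))).
  rewrite -{2}(submxK k) mulmx_block !mulmx1 !mulmx0 !addr0 E12 E22.
  by rewrite det_lblock det1 mulr1.
by rewrite det_mulmx det_ublock det1 mul1r.
Qed.

(** The Schur complement of the upper left block is the inverse of the lower right block of Y^-1. So
    only the upper rows of Y and the right columns of Y^-1 need to be controlled, which are those
    that the backward flow contracts. *)
Lemma lower_reduce (Y : 'M[R]_d) : \det Y != 0 -> \det (ulsubmx Y) != 0 ->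
  lower_mx (- (dlsubmx Y *m invmx (ulsubmx Y))) *m Y =
  block_mx (ulsubmx Y) (ursubmx Y) 0 (invmx (drsubmx (invmx Y))).
Proof.
move=> Y0 Y110; have Yu : Y \in unitmx by rewrite unitmxE unitfE.
have Y11u : ulsubmx Y \in unitmx by rewrite unitmxE unitfE.
pose V := invmx Y; have := mulmxV Yu; rewrite -/V.
rewrite -{1}(submxK Y) -{1}(submxK V) mulmx_block [X in _ = X]scalar_mx_block.
move=> /eq_block_mx[_ E12 _ E22].
rewrite -{3}(submxK Y) mulmx_block !(mul0mx, mul1mx, addr0, mulNmx).
rewrite mulmxKV// addNr; congr block_mx.
set Sc := _ + _; have ScV : Sc *m drsubmx V = 1%:M.
  rewrite mulmxDl mulNmx -mulmxA.
  have -> : ursubmx Y *m drsubmx V = - (ulsubmx Y *m ursubmx V).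
    by apply/eqP; rewrite -addr_eq0 addrC E12.
  by rewrite mulmxN opprK !mulmxA mulmxKV.
have [Scu Vu] := mulmx1_unit ScV.
by rewrite -[LHS]mulmx1 -(mulmxV Vu) mulmxA ScV mul1mx.
Qed.

End HorosphericalOrbit.

Lemma mxlim_comp (T U : Type) (F : set_system T) (G : set_system U) (R : realType) m n
    (phi : T -> U) (f : U -> 'M[R]_(m, n)) A :
  phi x @[x --> F] `=>` G -> mxlim G f A -> mxlim F (fun x => f (phi x)) A.
Proof. by move=> phiG fA i j; exact: cvg_comp phiG (fA i j). Qed.

Lemma invmx_mulmx (K : comUnitRingType) n (A B : 'M[K]_n) :
  A \in unitmx -> B \in unitmx -> invmx (A *m B) = invmx B *m invmx A.
Proof.
move=> Au Bu; have ABu : A *m B \in unitmx by rewrite unitmx_mul Au.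
by rewrite -[RHS](mulmxK ABu) !mulmxA mulmxKV// mulVmx// mul1mx.
Qed.

(** * Block diagonal matrices in the closure of the orbit *)

Section Density.
Context (R : realType) (m n : nat).
Local Notation zmx := (map_mx (intr : int -> R)).
Local Notation d := (m.+1 + n.+1)%N.
Local Notation flow := (g_flow m.+1 n.+1 : R -> 'M[R]_d).
Context (g0 : 'M[R]_d) (g01 : \det g0 = 1).

Lemma flow_mull t (M : 'M[R]_d) :
  ulsubmx (flow t *m M) = ulsubmx (expR (t / m.+1%:R) *: M) /\
  ursubmx (flow t *m M) = ursubmx (expR (t / m.+1%:R) *: M).
Proof.
rewrite /g_flow -(submxK M) mulmx_block !mul0mx !addr0 !mul_scalar_mx.
by rewrite scale_block_mx !block_mxKul !block_mxKur.
Qed.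

Lemma flow_mulr t (M : 'M[R]_d) :
  drsubmx (M *m flow t) = drsubmx (expR (- t / n.+1%:R) *: M).
Proof.
rewrite /g_flow -(submxK M) mulmx_block !mulmx0 !add0r !mul_mx_scalar.
by rewrite scale_block_mx !block_mxKdr.
Qed.

Lemma flow_unit t : flow t \in unitmx.
Proof. by rewrite unitmxE det_g_flow unitr1. Qed.

(* The bounded basis at time [t], times the integer matrix [G], flowed back to time
   0: modulo left multiplication by [lower_mx] it converges to a block diagonal
   matrix. *)
Lemma adherent_tied (F : set_system R) (PF : ProperFilter F) (a : R -> 'M[int]_d)
    (W : 'M[R]_d) (u : 'M[R]_m.+1) (v : 'M[R]_n.+1) :
  +oo `<=` F -> (forall t, a t \in unitmx) ->
  mxlim F (fun t => flow t *m g0 *m zmx (a t)) W ->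
  \det W != 0 -> \det (ulsubmx W) != 0 -> tied_diagonals u v ->
  adherent (lower_orbit g0) (block_mx (ulsubmx W *m u) 0 0
    (invmx (v *m drsubmx (invmx W)))).
Proof.
move=> FF au WF W0 W110 uv; have [G [Gu GF GiF]] := unimodular_family uv.
have [u0 v0] : \det u != 0 /\ \det v != 0.
  have [L1 [R1 [L2 [R2 [d1 [d2 [[L1u R1u L2u R2u] -> -> [d12 d10]]]]]]]] := uv.
  rewrite -!(normr_eq0 (\det _)) !det_mulmx !det_diag !normrM !norm_det_zmx//.
  by rewrite !mul1r !mulr1 -d12 normr_eq0.
(* With this choice X^-(n+1) and X^-(m+1), for the shifted m and n, are the factors e^(-t/(m+1)) and
   e^(-t/(n+1)) of the flow. *)
pose X (t : R) : R := expR (t / (m.+1 * n.+1)%:R).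
have XF : X t @[t --> F] --> +oo.
  apply/cvgryPge => A; apply: FF.
  have mn0 : 0 < (m.+1 * n.+1)%:R :> R by rewrite ltr0n muln_gt0.
  apply: filterS (nbhs_pinfty_ge (num_real ((A - 1) * (m.+1 * n.+1)%:R))) => t At.
  by apply: le_trans (expR_ge1Dx _); rewrite -lerBlDl ler_pdivlMr.
have [m0 n0] : m.+1%:R != 0 :> R /\ n.+1%:R != 0 :> R by rewrite !pnatr_eq0.
have Xm t : (X t)^-1 ^+ n.+1 = expR (- t / m.+1%:R).
  rewrite -expRN -expRM_natl; congr expR; rewrite natrM.
  by move: (m.+1%:R) (n.+1%:R) m0 n0 => p q p0 q0; field; rewrite ?p0 ?q0.
have Xn t : (X t)^-1 ^+ m.+1 = expR (- t / n.+1%:R).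
  rewrite -expRN -expRM_natl; congr expR; rewrite natrM.
  by move: (m.+1%:R) (n.+1%:R) m0 n0 => p q p0 q0; field; rewrite ?p0 ?q0.
pose k t := flow t *m g0 *m zmx (a t).
have ku t : k t \in unitmx.
  by rewrite !unitmx_mul flow_unit zmx_unit// unitmxE g01 unitr1.
pose Y t := flow (- t) *m (k t *m zmx (G (X t))).
have kGu t : k t *m zmx (G (X t)) \in unitmx by rewrite unitmx_mul ku zmx_unit.
have Yu t : Y t \in unitmx by rewrite unitmx_mul flow_unit kGu.
have YE t : Y t = g0 *m zmx (a t *m G (X t)).
  by rewrite /Y /k !mulmxA g_flowM addNr g_flow0 mul1mx map_mxM mulmxA.
(* The scalings in [top] and [bot] are exactly what [flow (- t)] does to the upper rows of the
   product and [flow t] to the right columns of its inverse. *)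
have top : mxlim F (fun t => (X t)^-1 ^+ n.+1 *: (k t *m zmx (G (X t))))
    (W *m (block_mx u 0 0 0 : 'M[R]_d)).
  by apply: mxlim_ext (mxlimM WF (mxlim_comp XF GF)) => t; rewrite scalemxAr.
have bot : mxlim F (fun t => (X t)^-1 ^+ m.+1 *: invmx (k t *m zmx (G (X t))))
    ((block_mx 0 0 0 v : 'M[R]_d) *m invmx W).
  apply: mxlim_ext (mxlimM (mxlim_comp XF GiF) (mxlim_inv WF W0)) => t.
  by rewrite -scalemxAl invmx_mulmx ?ku ?zmx_unit.
have ul : mxlim F (fun t => ulsubmx (Y t)) (ulsubmx W *m u).
  have -> : ulsubmx W *m u = ulsubmx (W *m (block_mx u 0 0 0 : 'M[R]_d)).
    rewrite -{2}(submxK W) mulmx_block block_mxKul.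
    by rewrite mulmx0 addr0.
  by apply: mxlim_ext (mxlim_ulsub top) => t; rewrite Xm; case: (flow_mull (- t) (k t *m zmx (G (X t)))).
have ur : mxlim F (fun t => ursubmx (Y t)) 0.
  have -> : 0 = ursubmx (W *m (block_mx u 0 0 0 : 'M[R]_d)).
    by rewrite -(submxK W) mulmx_block block_mxKur !mulmx0 addr0.
  by apply: mxlim_ext (mxlim_ursub top) => t; rewrite Xm; case: (flow_mull (- t) (k t *m zmx (G (X t)))).
have dr : mxlim F (fun t => drsubmx (invmx (Y t))) (v *m drsubmx (invmx W)).
  have -> : v *m drsubmx (invmx W) = drsubmx ((block_mx 0 0 0 v : 'M[R]_d) *m invmx W).
    rewrite -{2}(submxK (invmx W)) mulmx_block block_mxKdr.
    by rewrite mul0mx add0r.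
  apply: mxlim_ext (mxlim_drsub bot) => t; rewrite Xn -flow_mulr; congr drsubmx.
  rewrite /Y invmx_mulmx ?flow_unit ?kGu//; congr (_ *m _).
  by rewrite -[LHS]mulmx1 -g_flow0 -(addNr t) -g_flowM mulmxA mulVmx ?flow_unit// mul1mx.
have V0 : \det (v *m drsubmx (invmx W)) != 0.
  rewrite det_mulmx mulf_neq0//; move: W110; rewrite det_ulsub_inv// mulf_eq0.
  by rewrite negb_or => /andP[].
pose c t := - (dlsubmx (Y t) *m invmx (ulsubmx (Y t))).
apply: (adherent_lim (F := F) (f := fun t => lower_mx (c t) *m Y t)).
  apply: nearW => t; apply: adherent_self; exists (c t), (a t *m G (X t)).
  by rewrite unitmx_mul au Gu YE mulmxA.
apply: (mxlim_near (g := fun t => block_mx (ulsubmx (Y t)) (ursubmx (Y t)) 0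
    (invmx (drsubmx (invmx (Y t)))))).
  apply: filterS (near_det_neq0 ul _) => [t Y0|]; last by rewrite det_mulmx mulf_neq0.
  by rewrite lower_reduce// -unitfE -unitmxE.
by apply: mxlim_block => //; [exact: mxlim_cst|exact: mxlim_inv].
Unshelve. all: by end_near. Qed.

(** [adherent_tied] reaches the products of the blocks of the limit basis [W] with tied pairs. Such
    pairs approximate all pairs with equal nonzero absolute determinants, and adherence passes to
    the limit. *)
Lemma adherent_block_diag (e : R) (u : 'M[R]_m.+1) (v : 'M[R]_n.+1) : 0 < e ->
  (\forall t \near +oo, lattice_min (flow t *m g0) e) ->
  `|\det u * \det v| = 1 ->
  adherent (lower_orbit g0) (block_mx u 0 0 v).
Proof.
move=> e0 g0e uv1.
have [K K0 mahler] := mahler_compactness d 1 e0.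
have /choice[a aP] : forall t, exists a : 'M[int]_d, a \in unitmx /\
    (lattice_min (flow t *m g0) e ->
      forall i j, `|(flow t *m g0 *m zmx a) i j| <= K).
  (* At times without the lower bound the identity serves as a default; only large times matter. *)
  move=> t; have [te|te] := pselect (lattice_min (flow t *m g0) e); last first.
    by exists 1%:M; split; first exact: unitmx1.
  have detfg : \det (flow t *m g0) = 1 by rewrite det_mulmx det_g_flow g01 mulr1.
  have [||a au aK] := mahler (flow t *m g0) _ _ te; rewrite ?detfg ?oner_eq0 ?normr1//.
  by exists a.
have [F [UF oF]] := ultraFilterLemma (@proper_pinfty_nbhs R).
have PF : ProperFilter F by exact: ultra_proper.
have [k kF] : exists k, mxlim F (fun t => flow t *m g0 *m zmx (a t)) k.
  apply: (@ultra_bounded_mxlim _ _ UF _ _ _ _ K); apply: oF.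
  by apply: filterS g0e => t; case: (aP t).
have k1 : `|\det k| = 1.
  apply: (cvg_unique (@norm_hausdorff _ R) (cvg_norm (cvg_det kF))).
  apply: cvg_ext (cvg_cst (1 : R)) => t.
  by rewrite !det_mulmx det_g_flow g01 !mul1r norm_det_zmx//; case: (aP t).
have k0 : \det k != 0 by rewrite -normr_eq0 k1 oner_eq0.
have [b bu kb] := invertible_corner k0.
pose W := k *m zmx b.
have WF : mxlim F (fun t => flow t *m g0 *m zmx (a t *m b)) W.
  by apply: mxlim_ext (mxlimM kF (mxlim_cst (zmx b))) => t; rewrite map_mxM !mulmxA.
have W1 : `|\det W| = 1 by rewrite det_mulmx normrM k1 norm_det_zmx// mulr1.
have W0 : \det W != 0 by rewrite -normr_eq0 W1 oner_eq0.
have ab t : a t *m b \in unitmx by rewrite unitmx_mul bu andbT; case: (aP t).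
have [u0 v0] : \det u != 0 /\ \det v != 0.
  apply/andP; rewrite -negb_or -mulf_eq0 -normr_eq0 uv1; exact: oner_neq0.
have VW := det_ulsub_inv W0.
have V0 : \det (drsubmx (invmx W)) != 0.
  by move: kb; rewrite -/W VW mulf_eq0 negb_or => /andP[].
(* Chosen so that W11 u' = u and (v' V22)^-1 = v, where V = W^-1. Their determinants agree in
   absolute value because |det W11| = |det V22| and |det u det v| = 1. *)
pose u' := invmx (ulsubmx W) *m u; pose v' := invmx v *m invmx (drsubmx (invmx W)).
have [||f [g [fu gv fg]]] := @tied_diagonals_approx R m n u' v'.
- rewrite /u' /v' !det_mulmx !det_inv !normrM !normfV VW normrM W1 mul1r.
  have : `|\det u| = `|\det v|^-1.
    by apply/(mulIf (_ : `|\det v| != 0)); rewrite ?normr_eq0// mulVf ?normr_eq0// -normrM.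
  by move=> ->; rewrite mulrC.
- by rewrite det_mulmx det_inv mulf_neq0// invr_eq0.
apply: (adherent_lim (F := (+oo : set_system R)) (f := fun X =>
    block_mx (ulsubmx W *m f X) 0 0 (invmx (g X *m drsubmx (invmx W))))).
  by apply: filterS fg => X fgX; exact: (@adherent_tied F PF (fun t => a t *m b) W _ _ oF ab WF W0 kb fgX).
have -> : u = ulsubmx W *m u' by rewrite mulKVmx// unitmxE unitfE.
have -> : v = invmx (v' *m drsubmx (invmx W)).
  by rewrite /v' mulmxKV ?invmxK// unitmxE unitfE.
apply: mxlim_block; [|exact: mxlim_cst|exact: mxlim_cst|].
  by apply: mxlimM => //; exact: mxlim_cst.
apply: mxlim_inv; first by apply: mxlimM => //; exact: mxlim_cst.
by rewrite /v' mulmxKV ?unitmxE ?unitfE// det_inv invr_eq0.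
Qed.
End Density.

(** * Density of the whole orbit *)

Section OrbitDensity.
Context (R : realType) (m n : nat).
Local Notation zmx := (map_mx (intr : int -> R)).
Local Notation d := (m.+1 + n.+1)%N.
Local Notation flow := (g_flow m.+1 n.+1 : R -> 'M[R]_d).

(** Make the upper rows rational. In the Smith form L S K of their integer numerators S vanishes
    outside its left block, so removing K clears the upper right block. Scaling the first lower row
    by [rho], which tends to 1, restores the determinant. *)
Lemma parabolic_approx (h : 'M[R]_d) : \det h = 1 ->
  exists2 f : R -> 'M[R]_d, mxlim +oo f h &
  \forall X \near (+oo : set_system R), exists q (b : 'M[int]_d),
    [/\ f X = q *m zmx b, ursubmx q = 0, b \in unitmx & `|\det q| = 1].
Proof.
move=> h1.
pose M (X : R) : 'M[int]_(m.+1, d) := \matrix_(i, j) Num.floor (X * h (lshift _ i) j).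
pose Tp X := X^-1 *: zmx (M X).
have TpM : mxlim +oo Tp (usubmx h).
  move=> i j; rewrite [X in _ --> X]mxE.
  by apply: cvg_ext (@cvg_floor_ratio R (h (lshift _ i) j)) => X; rewrite !mxE.
have colM : mxlim +oo (fun X => col_mx (Tp X) (dsubmx h)) h.
  rewrite -{2}(vsubmxK h); apply: mxlim_col => //; exact: mxlim_cst.
pose rho X := (\det (col_mx (Tp X) (dsubmx h)))^-1.
have rho1 : rho X @[X --> (+oo : set_system R)] --> (1 : R).
  by rewrite -[X in _ --> X]invr1 -h1; apply: cvgV (cvg_det colM); rewrite h1 oner_neq0.
pose D X : 'rV[R]_n.+1 := \row_j (if j == 0 then rho X else 1).
have D1 : mxlim +oo (fun X => diag_mx (D X)) 1%:M.
  move=> i j; rewrite [X in _ --> X]mxE; have [ij|ij] := eqVneq i j; last first.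
    by apply: cvg_ext (cvg_cst _) => X; rewrite mxE (negPf ij).
  have [j0|j0] := eqVneq j 0.
    by apply: cvg_ext rho1 => X; rewrite !mxE ij eqxx j0 eqxx.
  by apply: cvg_ext (cvg_cst _) => X; rewrite !mxE ij eqxx (negPf j0).
exists (fun X => col_mx (Tp X) (diag_mx (D X) *m dsubmx h)).
  rewrite -{2}(vsubmxK h); apply: mxlim_col => //; rewrite -[X in mxlim _ _ X]mul1mx.
  by apply: mxlimM => //; exact: mxlim_cst.
have h0 : \det h != 0 by rewrite h1 oner_neq0.
apply: filterS (near_det_neq0 colM h0) => X X0.
have detf : \det (col_mx (Tp X) (diag_mx (D X) *m dsubmx h)) = 1.
  have -> : col_mx (Tp X) (diag_mx (D X) *m dsubmx h) =
      block_mx 1%:M 0 0 (diag_mx (D X)) *m col_mx (Tp X) (dsubmx h).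
    by rewrite mul_block_col !mul0mx mul1mx addr0 add0r.
  rewrite det_mulmx det_ublock det1 mul1r det_diag big_ord_recl mxE eqxx.
  rewrite big1 => [|j _]; last by rewrite mxE.
  by rewrite mulr1 mulVf.
have [L Lu [K Ku [s _ ME]]] := int_Smith_normal_form (M X).
pose S : 'M[int]_(m.+1, d) := \matrix_(i, j) (s`_i *+ (i == j :> nat)).
exists (col_mx (X^-1 *: zmx (L *m S)) (diag_mx (D X) *m dsubmx h *m zmx (invmx K))), K.
have fE : col_mx (Tp X) (diag_mx (D X) *m dsubmx h) =
    col_mx (X^-1 *: zmx (L *m S)) (diag_mx (D X) *m dsubmx h *m zmx (invmx K)) *m zmx K.
  rewrite mul_col_mx -(mulmxA _ (zmx (invmx K))) -map_mxM mulVmx// map_mx1 mulmx1.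
  by rewrite /Tp ME -/S map_mxM scalemxAl.
split => //.
  have S0 : rsubmx S = 0.
    apply/matrixP => i j; rewrite !mxE /= ltn_eqF//.
    by rewrite ltn_addr.
  apply/matrixP => i j; rewrite mxE mxE col_mxEu !mxE big1 ?mulr0// => l _.
  have := congr1 (fun N : 'M[int]__ => N l j) S0; rewrite !mxE => ->.
  by rewrite mulr0.
have := congr1 (fun N : 'M[R]_d => `|\det N|) fE; rewrite detf normr1.
by rewrite det_mulmx normrM norm_det_zmx// mulr1.
Qed.

Lemma lower_orbit_dense (g h : 'M[R]_d) (e : R) : \det g = 1 -> 0 < e ->
  (\forall t \near +oo, lattice_min (flow t *m g) e) ->
  \det h = 1 -> adherent (lower_orbit g) h.
Proof.
move=> g1 e0 ge /parabolic_approx[f fh fq].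
apply: adherent_lim fh; apply: filterS fq => X [q [b [-> q12 bu q1]]].
apply: adherent_zmx => //.
have qE : q = block_mx (ulsubmx q) 0 (dlsubmx q) (drsubmx q) by rewrite -q12 submxK.
have detq : `|\det (ulsubmx q) * \det (drsubmx q)| = 1.
  by rewrite -(det_lblock _ (dlsubmx q)) -qE.
have q11u : ulsubmx q \in unitmx.
  rewrite unitmxE unitfE; apply: contra_eq_neq detq => ->.
  by rewrite mul0r normr0 eq_sym oner_eq0.
have -> : q = lower_mx (dlsubmx q *m invmx (ulsubmx q)) *m
    block_mx (ulsubmx q) 0 0 (drsubmx q).
  by rewrite {1}qE mulmx_block !(mul0mx, mulmx0, mul1mx, addr0, add0r) mulmxKV.
exact/adherent_lower/(adherent_block_diag g1 e0 ge).
Qed.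
End OrbitDensity.

(** * Norms, the function delta and its liminf *)

Section Norms.
Context (R : realType) (m : nat) (N : 'cV[R]_m -> R) (normN : is_norm N).

Lemma is_normD u v : N (u + v) <= N u + N v. Proof. by case: normN. Qed.
Lemma is_normZ (a : R) v : N (a *: v) = `|a| * N v. Proof. by case: normN. Qed.
Lemma is_norm_eq0 v : N v = 0 -> v = 0. Proof. by case: normN => _ _; apply. Qed.

Lemma is_norm0 : N 0 = 0.
Proof. by rewrite -(scale0r 0) is_normZ normr0 mul0r. Qed.

Lemma is_norm_ge0 v : 0 <= N v.
Proof.
have := is_normD v ((-1) *: v); rewrite is_normZ normrN1 mul1r scaleN1r subrr is_norm0.
by rewrite -mulr2n pmulrn_lge0.
Qed.

Lemma is_norm_upper : exists2 K, 0 < K & forall v, N v <= K * `|v|.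
Proof.
exists (1 + \sum_i N (delta_mx i 0)) => [|v].
  by rewrite ltr_pwDl// sumr_ge0// => i _; exact: is_norm_ge0.
have -> : N v = N (\sum_i v i 0 *: delta_mx i 0).
  congr N; rewrite [LHS]matrix_sum_delta; apply: eq_bigr => i _.
  by rewrite big_ord1.
apply: (@le_trans _ _ (\sum_i `|v i 0| * N (delta_mx i 0))).
  elim/big_ind2: _ => [|x1 x2 y1 y2 h1 h2|i _]; first by rewrite is_norm0.
    by apply: le_trans (is_normD _ _) _; exact: lerD.
  by rewrite is_normZ.
rewrite mulrDl mul1r mulr_suml -[leLHS]add0r lerD// ler_sum// => i _.
by rewrite mulrC ler_wpM2l ?is_norm_ge0// mx_norm_entry.
Qed.

(** Otherwise unit vectors with N tending to 0 have a limit along an ultrafilter; the triangle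
    inequality and the upper bound give N = 0 there, so the limit is 0, against the unit norm. *)
Lemma is_norm_lower : exists2 k, 0 < k & forall v, k * `|v| <= N v.
Proof.
have [K K0 NK] := is_norm_upper.
apply: contrapT => nk.
have /choice[w wP] : forall j : nat, exists w, `|w| = 1 /\ N w < j.+1%:R^-1.
  move=> j; apply: contrapT => nw; apply: nk; exists j.+1%:R^-1; rewrite ?invr_gt0//.
  move=> v; rewrite leNgt; apply/negP => vN; apply: nw; exists (`|v|^-1 *: v).
  have v0 : 0 < `|v|.
    rewrite normr_gt0; apply/negP => /eqP v0.
    by move: vN; rewrite v0 normr0 mulr0 is_norm0 ltxx.
  rewrite normrZ is_normZ normfV normr_id mulVf ?gt_eqF//; split => //.
  by rewrite mulrC ltr_pdivrMr.
have [F [UF oF]] := @ultraFilterLemma _ (\oo : set_system nat) _.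
have PF : ProperFilter F by exact: ultra_proper.
have [w0 wF] : exists w0, mxlim F w w0.
  apply: (@ultra_bounded_mxlim _ _ UF _ _ _ _ 1); apply: nearW => j a b.
  by have [<- _] := wP j; exact: mx_norm_entry.
have near0 e : 0 < e -> \forall j \near F, `|w0 - w j| <= e.
  move=> e0; apply: filterS (mxlim_dist e0 wF) => j wj.
  by apply: mx_norm_le => [|a b]; [exact: ltW|rewrite !mxE ltW].
have w00 : w0 = 0.
  apply: is_norm_eq0; apply/eqP; rewrite eq_le is_norm_ge0 andbT.
  apply/ler_addgt0Pr => e e0; rewrite add0r.
  have e2 : 0 < e / 2 by rewrite divr_gt0.
  have eK : 0 < e / 2 / K by rewrite divr_gt0.
  have small : \forall j \near F, N (w j) < e / 2.
    apply: oF; have := near_infty_natSinv_lt (PosNum e2).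
    by apply: filterS => j; case: (wP j) => _ Nw; exact: lt_trans.
  have [j [wj Nwj]] := filter_ex (filterI (near0 _ eK) small).
  rewrite -(subrK (w j) w0) (le_trans (is_normD _ _))// [leRHS]splitr lerD ?(ltW Nwj)//.
  by rewrite (le_trans (NK _))// mulrC -ler_pdivlMr.
have [j] := filter_ex (near0 _ (divr_gt0 ltr01 (ltr0Sn R 1))).
by rewrite w00 sub0r normrN; case: (wP j) => -> _; lra.
Qed.

Lemma mulmx_norm p q (A : 'M[R]_(p, q)) (v : 'cV[R]_q) e : 0 <= e ->
  (forall i j, `|A i j| <= e) -> `|A *m v| <= q%:R * e * `|v|.
Proof.
move=> e0 Ae; apply: mx_norm_le => [|i j]; first by rewrite !mulr_ge0.
rewrite mxE (le_trans (ler_norm_sum _ _ _))//.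
rewrite -mulrA mulr_natl -[X in _ *+ X](card_ord q) -sumr_const ler_sum// => k _.
by rewrite normrM ler_pM ?mx_norm_entry.
Qed.

Lemma is_norm_near_id k : 0 < k -> exists2 e, 0 < e & forall a : 'M[R]_m,
  (forall i j, `|(1%:M : 'M[R]_m) i j - a i j| < e) -> forall y, N (a *m y) <= (1 + k) * N y.
Proof.
move=> k0; have [K K0 NK] := is_norm_upper; have [c c0 Nc] := is_norm_lower.
(* Using m+1 in place of m keeps the divisor positive for m = 0. *)
have mK : 0 < m.+1%:R * K by rewrite mulr_gt0.
have [e e0 ekc] : exists2 e, 0 < e & e * (m.+1%:R * K) = k * c.
  by exists (k * c / (m.+1%:R * K)); rewrite ?divfK ?gt_eqF// divr_gt0// mulr_gt0.
exists e => // a ae y.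
have -> : a *m y = y + (a - 1%:M) *m y by rewrite mulmxBl mul1mx addrC subrK.
rewrite (le_trans (is_normD _ _))// mulrDl mul1r lerD2l.
rewrite (le_trans (NK _))// (@le_trans _ _ (K * (m%:R * e * `|y|)))//.
  rewrite ler_pM2l// mulmx_norm ?ltW// => i j.
  by have := ae i j; rewrite distrC !mxE => /ltW.
rewrite (@le_trans _ _ (k * (c * `|y|)))//; last by rewrite ler_pM2l.
rewrite !mulrA ler_wpM2r// -ekc.
have -> : K * m%:R * e = e * (m%:R * K) by ring.
by rewrite ler_pM2l// ler_pM2r// ler_nat.
Qed.
End Norms.

(** * Lower limits at infinity *)

Section LimInf.
Context (R : realType).
Local Notation L f := (limf_einf (fun t : R => (f t)%:E) (pinfty_nbhs R)).

Lemma limf_einf_ge (f : R -> R) (s : R) :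
  (\forall t \near +oo, s <= f t) -> (s%:E <= L f)%E.
Proof.
move=> sf; rewrite limf_einfE.
apply: (@le_trans _ _ (ereal_inf [set (f t)%:E | t in [set t | s <= f t]])).
  by apply: le_ereal_inf_tmp => _ [t st <-]; rewrite lee_fin.
by apply: ereal_sup_ubound; exists [set t | s <= f t].
Qed.

Lemma limf_einf_gt (f : R -> R) (s : R) : (s%:E < L f)%E ->
  exists2 r, s < r & \forall t \near +oo, r <= f t.
Proof.
rewrite limf_einfE => /ereal_sup_gt[_ [V FV <-] sV].
have [r sr rV] : exists2 r, s < r & (r%:E <= ereal_inf [set (f t)%:E | t in V])%E.
  move: sV; case: ereal_inf => [r||] //; last by exists (s + 1); rewrite ?ltrDl// leey.
  by rewrite lte_fin => sr; exists r.
exists r => //; apply: filterS FV => t Vt; rewrite -lee_fin (le_trans rV)//.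
by apply: ereal_inf_lbound; exists t.
Qed.

Lemma limf_einf_le (f g : R -> R) (C l : R) : 0 < C ->
  (\forall t \near +oo, f t <= C * g t) -> L g = l%:E -> (L f <= (C * l)%:E)%E.
Proof.
move=> C0 fg gl; rewrite leNgt; apply/negP => /limf_einf_gt[r lr rf].
have : ((r / C)%:E <= L g)%E.
  apply: limf_einf_ge; apply: filterS (filterI fg rf) => t [fgt rft].
  by rewrite ler_pdivrMr// mulrC (le_trans rft).
by rewrite gl lee_fin ler_pdivrMr// mulrC leNgt lr.
Qed.

(** Nonnegativity of [f] excludes -oo and comparison with [g] excludes +oo, so the lower limit of
    [f] is real and the comparison can be reversed. *)
Lemma limf_einf_close (f g : R -> R) (C l : R) : 1 <= C ->
  (\forall t \near +oo, 0 <= f t) ->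
  (\forall t \near +oo, f t <= C * g t) -> (\forall t \near +oo, g t <= C * f t) ->
  L g = l%:E -> exists2 l', L f = l'%:E & l <= C * l' /\ l' <= C * l.
Proof.
move=> C1 f0 fg gf gl; have C0 : 0 < C by apply: lt_le_trans C1.
have := limf_einf_le C0 fg gl; have := limf_einf_ge f0.
case fE : (L f) => [l'||] // _; rewrite lee_fin => l'l; exists l' => //; split => //.
by have := limf_einf_le C0 gf fE; rewrite gl lee_fin.
Qed.
End LimInf.

(** * Effect of block lower triangular matrices on the lower limit *)

Section Flow.
Context (R : realType) (m n : nat).
Local Notation zmx := (map_mx (intr : int -> R)).
Local Notation d := (m.+1 + n.+1)%N.
Local Notation flow := (g_flow m.+1 n.+1 : R -> 'M[R]_d).
Context (rho : 'cV[R]_m.+1 -> R) (sigma : 'cV[R]_n.+1 -> R).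
Context (hrho : is_norm rho) (hsigma : is_norm sigma).
Local Notation eta := (eta_norm rho sigma).

Lemma lattice_actE (g h : 'M[R]_d) : lattice_act g (lattice_of h) = lattice_of (g *m h).
Proof.
rewrite /lattice_act /lattice_of image_comp; congr image; apply/funext => v /=.
by rewrite mulmxA.
Qed.

Lemma lattice_of_zmx (g : 'M[R]_d) (a : 'M[int]_d) : a \in unitmx ->
  lattice_of (g *m zmx a) = lattice_of g.
Proof.
move=> au; apply/seteqP; split=> [_ [z _ <-]|_ [z _ <-]].
  by exists (a *m z) => //; rewrite map_mxM mulmxA.
exists (invmx a *m z) => //.
by rewrite -mulmxA -map_mxM mulKVmx.
Qed.

Lemma eta_ge0 v : 0 <= eta v.
Proof. by rewrite /eta_norm le_max (is_norm_ge0 hrho). Qed.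

Lemma eta_upper : exists2 K, 0 < K & forall v : 'cV[R]_d, eta v <= K * `|v|.
Proof.
have [K1 K10 NK1] := is_norm_upper hrho; have [K2 K20 NK2] := is_norm_upper hsigma.
exists (Num.max K1 K2) => [|v]; first by rewrite lt_max K10.
have usub : `|usubmx v| <= `|v|.
  by apply: mx_norm_le => // i j; rewrite mxE mx_norm_entry.
have dsub : `|dsubmx v| <= `|v|.
  by apply: mx_norm_le => // i j; rewrite mxE mx_norm_entry.
rewrite /eta_norm ge_max (le_trans (NK1 _)) ?(le_trans (NK2 _))//.
- by rewrite ler_pM// ?le_max ?lexx ?orbT// ltW.
- by rewrite ler_pM// ?le_max ?lexx// ltW.
Qed.

Lemma delta_ge0 (x : set 'cV[R]_d) : 0 <= delta eta x.
Proof.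
rewrite /delta; have [->|/set0P x0] := eqVneq (eta @` (x `\ 0)) set0; first by rewrite inf0.
by apply: lb_le_inf => // _ [v _ <-]; exact: eta_ge0.
Qed.

Lemma delta_le (x x' : set 'cV[R]_d) (p : 'M[R]_d) C : 0 < C -> x `\ 0 !=set0 ->
  p \in unitmx -> lattice_act p x `<=` x' -> (forall v, eta (p *m v) <= C * eta v) ->
  delta eta x' <= C * delta eta x.
Proof.
move=> C0 [v0 xv0] pu px pC; rewrite -ler_pdivrMl//; apply: lb_le_inf.
  by exists (eta v0); exists v0.
move=> _ [v [xv v0'] <-]; rewrite ler_pdivrMl//; apply: le_trans (pC v).
apply: ge_inf; first by exists 0 => _ [w _ <-]; exact: eta_ge0.
exists (p *m v) => //; split; first by apply: px; exists v.
by move=> /= pv0; apply: v0'; rewrite /= -(mulKmx pu v) pv0 mulmx0.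
Qed.

Lemma eta_flow_parabolic (a : 'M[R]_m.+1) (b : 'M[R]_n.+1) c k : 0 < k ->
  (forall y, rho (a *m y) <= (1 + k) * rho y) ->
  (forall z, sigma (b *m z) <= (1 + k) * sigma z) ->
  \forall t \near +oo, forall v : 'cV[R]_d,
    eta (flow t *m block_mx a 0 c b *m flow (- t) *m v) <= (1 + k + k) * eta v.
Proof.
move=> k0 ak bk; have [K K0 sK] := is_norm_upper hsigma.
have [l l0 lr] := is_norm_lower hrho.
pose M := K * (m.+1%:R * `|c|) / l.
have M0 : 0 <= M by rewrite divr_ge0 ?(ltW l0)// mulr_ge0 ?(ltW K0)// mulr_ge0.
have cM y : sigma (c *m y) <= M * rho y.
  rewrite (le_trans (sK _))// (@le_trans _ _ (K * (m.+1%:R * `|c| * `|y|)))//.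
    by rewrite ler_pM2l// mulmx_norm// => i j; exact: mx_norm_entry.
  have -> : M * rho y = K * (m.+1%:R * `|c| * (l^-1 * rho y)) by rewrite /M; ring.
  by rewrite ler_pM2l// ler_wpM2l ?mulr_ge0// ler_pdivlMl.
(* Conjugation by the flow multiplies [c] by [e], at most e^(-t/(n+1)). Beyond the threshold
   e^(t/(n+1)) >= 1 + t/(n+1) >= M/k, so [c] contributes only the second k. *)
apply: filterS2 (nbhs_pinfty_ge (num_real 0)) (nbhs_pinfty_ge (num_real (M / k * n.+1%:R))).
move=> t t0 tM v.
pose e := expR (- t / n.+1%:R) * expR (- t / m.+1%:R).
have eM : e * M <= k.
  have : e <= expR (- t / n.+1%:R).
    rewrite /e -[leRHS]mulr1 ler_wpM2l ?expR_ge0// -[leRHS]expR0 ler_expR mulNr.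
    by rewrite oppr_le0 divr_ge0.
  move=> /(ler_wpM2r M0) eM; apply: le_trans eM _.
  rewrite mulNr expRN mulrC ler_pdivrMr ?expR_gt0// -ler_pdivrMl// mulrC.
  apply: le_trans (expR_ge1Dx _); rewrite (@le_trans _ _ (t / n.+1%:R)) ?lerDr//.
  by rewrite ler_pdivlMr.
have -> : flow t *m block_mx a 0 c b *m flow (- t) = block_mx a 0 (e *: c) b.
  rewrite /g_flow !mulmx_block !(mul0mx, mulmx0, addr0, add0r) !mul_scalar_mx.
  rewrite !mul_mx_scalar !scalerA -!expRD -!mulrDl opprK subrr addNr !mul0r expR0 !scale1r.
  by rewrite /e -expRD addrC.
rewrite -(vsubmxK v) mul_block_col mul0mx addr0 /eta_norm !col_mxKu !col_mxKd.
move: (usubmx v) (dsubmx v) => y z; set B := Num.max (rho y) (sigma z).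
have yB : rho y <= B by rewrite le_max lexx.
have zB : sigma z <= B by rewrite le_max lexx orbT.
have B0 : 0 <= B := le_trans (is_norm_ge0 hrho y) yB.
have kB : (1 + k) * B <= (1 + k + k) * B by rewrite ler_wpM2r// lerDl ltW.
have k1 : 0 <= 1 + k by rewrite addr_ge0// ltW.
rewrite ge_max (le_trans (ak _))/=; last by apply: le_trans kB; rewrite ler_wpM2l.
rewrite -scalemxAl (le_trans (is_normD hsigma _ _))// (is_normZ hsigma).
rewrite ger0_norm ?mulr_ge0 ?expR_ge0// addrC [leRHS]mulrDl lerD//.
  by rewrite (le_trans (bk _))// ler_wpM2l.
rewrite (le_trans (ler_wpM2l _ (cM y))) ?mulr_ge0 ?expR_ge0// mulrA ler_pM//.
  by rewrite (mulr_ge0 _ M0)// mulr_ge0 ?expR_ge0.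
exact: is_norm_ge0.
Qed.

Lemma delta_parabolic (g p : 'M[R]_d) (a : 'M[R]_m.+1) (b : 'M[R]_n.+1) c k : 0 < k ->
  g \in unitmx -> p \in unitmx -> p = block_mx a 0 c b ->
  (forall y, rho (a *m y) <= (1 + k) * rho y) ->
  (forall z, sigma (b *m z) <= (1 + k) * sigma z) ->
  \forall t \near +oo, delta eta (lattice_act (flow t) (lattice_of (p *m g))) <=
    (1 + k + k) * delta eta (lattice_act (flow t) (lattice_of g)).
Proof.
move=> k0 gu pu pE ak bk; apply: filterS (eta_flow_parabolic c k0 ak bk) => t tE.
have flowu s : flow s \in unitmx by rewrite unitmxE det_g_flow unitr1.
apply: (@delta_le _ _ (flow t *m p *m flow (- t))); last by rewrite pE.
- by rewrite !addr_gt0.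
- rewrite lattice_actE; exists (flow t *m g *m zmx (delta_mx 0 0)); split.
    by exists (delta_mx 0 0).
  move=> /= E; have : zmx (delta_mx 0 0 : 'cV_d) = 0.
    by rewrite -[LHS](mulKmx (_ : flow t *m g \in unitmx)) ?E ?mulmx0// unitmx_mul flowu.
  by move/matrixP => /(_ 0 0); rewrite !mxE !eqxx => /eqP; rewrite oner_eq0.
- by rewrite !unitmx_mul !flowu pu.
- rewrite !lattice_actE -!mulmxA (mulmxA (flow (- t))) g_flowM addNr g_flow0 mul1mx.
  exact: subset_refl.
Qed.

(** The one-sided estimate is applied to p and to its inverse; no bound on c or c' enters the
    constant, since the flow contracts them. *)
Lemma lambda_parabolic (g p : 'M[R]_d) (a a' : 'M[R]_m.+1) (b b' : 'M[R]_n.+1) c c' k l :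
  0 < k -> g \in unitmx ->
  p = block_mx a 0 c b -> p *m block_mx a' 0 c' b' = 1%:M ->
  (forall y, rho (a *m y) <= (1 + k) * rho y) ->
  (forall z, sigma (b *m z) <= (1 + k) * sigma z) ->
  (forall y, rho (a' *m y) <= (1 + k) * rho y) ->
  (forall z, sigma (b' *m z) <= (1 + k) * sigma z) ->
  lambdaF eta (lattice_of g) = l%:E ->
  exists2 l', lambdaF eta (lattice_of (p *m g)) = l'%:E &
    l <= (1 + k + k) ^+ d * l' /\ l' <= (1 + k + k) ^+ d * l.
Proof.
move=> k0 gu pE pp' ak bk ak' bk' gl; have [pu p'u] := mulmx1_unit pp'.
have p'p : block_mx a' 0 c' b' *m p = 1%:M by apply: mulmx1C.
have C0 : 0 <= 1 + k + k by rewrite !addr_ge0// ltW.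
apply: limf_einf_close gl.
- by rewrite exprn_ege1// -addrA lerDl addr_ge0// ltW.
- by apply: nearW => t; rewrite exprn_ge0// delta_ge0.
- apply: filterS (delta_parabolic k0 gu pu pE ak bk) => t.
  by rewrite -exprMn; apply: lerXn2r; rewrite nnegrE ?mulr_ge0 ?delta_ge0.
- have pgu : p *m g \in unitmx by rewrite unitmx_mul pu.
  apply: filterS (delta_parabolic k0 pgu p'u erefl ak' bk') => t.
  by rewrite mulmxA p'p mul1mx -exprMn; apply: lerXn2r; rewrite nnegrE ?mulr_ge0 ?delta_ge0.
Qed.

Lemma lambda_gt0_lattice_min (g : 'M[R]_d) : g \in unitmx ->
  (0 < lambdaF eta (lattice_of g))%E ->
  exists2 e, 0 < e & \forall t \near +oo, lattice_min (flow t *m g) e.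
Proof.
move=> gu /limf_einf_gt[s s0 sd]; have [K K0 etaK] := eta_upper.
(* If delta <= 1 then s <= delta^d <= delta, as d >= 1; hence delta >= min(1, s), and K passes from
   [eta] to the sup norm. *)
exists (Num.min 1 s / K) => [|]; first by rewrite divr_gt0// lt_min ltr01.
apply: filterS sd => t st z z0; rewrite ler_pdivrMr// mulrC; apply: le_trans (etaK _).
set v := _ *m _; have v0 : v != 0.
  have fgu : flow t *m g \in unitmx by rewrite unitmx_mul unitmxE det_g_flow unitr1.
  apply: contraNneq z0 => v0; apply/eqP/matrixP => i j.
  have := congr1 (fun w => invmx (flow t *m g) *m w) v0; rewrite /v mulKmx// mulmx0.
  by move=> /matrixP/(_ i j); rewrite !mxE => /eqP; rewrite intr_eq0 => /eqP.
have dv : delta eta (lattice_act (flow t) (lattice_of g)) <= eta v.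
  apply: ge_inf; first by exists 0 => _ [w _ <-]; exact: eta_ge0.
  by exists v => //; split; [rewrite lattice_actE; exists z|exact/eqP].
apply: le_trans dv; rewrite ge_min; have [//|/ltW d1 /=] := leP 1 (delta eta _).
apply: le_trans st _; move: d1 (delta_ge0 (lattice_act (flow t) (lattice_of g))).
by move: (delta _ _) => y y1 y0; rewrite addSn exprS ler_piMr// exprn_ile1.
Qed.
End Flow.

Lemma bernoulli_choice (R : realType) (d : nat) (e : R) : 0 < e ->
  exists2 k, 0 < k & (1 + k + k) ^+ d <= 1 + e.
Proof.
move=> e0.
have e1 : 1 < 1 + e by rewrite ltrDl.
(* From 1 + 2k <= e^(2k) the d-th power is at most (1 + e)^(d/(d+1)); d+1 also avoids division by
   zero. *)
exists (ln (1 + e) / (d.+1%:R * 2)) => [|].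
  by rewrite divr_gt0 ?ln_gt0// mulr_gt0.
set k := _ / _; have -> : 1 + k + k = 1 + k * 2 by ring.
have k2 : k * 2 = ln (1 + e) / d.+1%:R.
  by rewrite /k invfM mulrA -mulrA mulVf ?mulr1.
have k20 : 0 <= k * 2 by rewrite k2 divr_ge0 ?ln_ge0 ?ltW.
apply: (@le_trans _ _ (expR (k * 2) ^+ d)).
  by apply: lerXn2r; rewrite ?nnegrE ?addr_ge0 ?expR_ge0// expR_ge1Dx.
rewrite -expRM_natl k2 -[leRHS]lnK ?posrE ?(lt_trans ltr01)// ler_expR.
by rewrite mulrA ler_pdivrMr// mulrC ler_wpM2l ?ln_ge0 ?(ltW e1)// ler_nat.
Qed.

(** * Perturbation of a given matrix into the orbit of x_0 *)

Unset Implicit Arguments.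
Set Strict Implicit.
Set Printing Implicit Defensive.

Theorem theorem1p4 (R : realType) (m n : nat)
    (hm : (0 < m)%N) (hn : (0 < n)%N) (hmn : (1 < maxn m n)%N)
    (rho : 'cV[R]_m -> R) (sigma : 'cV[R]_n -> R)
    (hrho : is_norm rho) (hsigma : is_norm sigma)
    (x0 : set 'cV[R]_(m + n)) (hx0 : unimodular_lattices x0)
    (hlambda : (0 < lambdaF (eta_norm rho sigma) x0)%E)
    (x : set 'cV[R]_(m + n)) (hx : unimodular_lattices x)
    (I : set R) (I_nonempty : I !=set0) (I_open : open I)
    (I_interval : is_interval I)
    (hI : (EFin @` I) (lambdaF (eta_norm rho sigma) x0)) :
  dense [set A : 'M[R]_(m, n) |
    (EFin @` I) (lambdaF (eta_norm rho sigma) (lattice_act (u_mx A) x))].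
Proof.
case: m hm rho hrho => // m _ rho hrho in hmn x0 hx0 hlambda x hx hI *.
case: n hn sigma hsigma => // n _ sigma hsigma in hmn x0 hx0 hlambda x hx hI *.
case: hx0 hlambda hI => g0 /= g01 <- hlambda [l Il /esym gl].
case: hx => g /= g1 <- {x x0 hmn I_nonempty I_interval}.
have g0u : g0 \in unitmx by rewrite unitmxE g01 unitr1.
have l0 : 0 < l by move: hlambda; rewrite gl lte_fin.
have [e e0 g0e] := lambda_gt0_lattice_min hrho hsigma g0u hlambda.
move/open_nbhs_nbhs: (conj I_open Il) => /nbhs_ballP[r /= r0 rI].
(* A ratio within 1 + r/(2l) of 1 moves the value l by at most r/2. *)
have [k k0 kd] := bernoulli_choice (m.+1 + n.+1) (divr_gt0 r0 (mulr_gt0 (ltr0Sn R 1) l0)).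
have [e1 e10 rhok] := is_norm_near_id hrho k0.
have [e2 e20 sigmak] := is_norm_near_id hsigma k0.
move=> O [B OB] oO.
move/open_nbhs_nbhs: (conj oO OB) => /nbhs_ballP[s /= s0 sO].
pose h := u_mx B *m g.
have h1 : \det h = 1 by rewrite det_mulmx g1 det_ublock !det1 !mulr1.
have hu : h \in unitmx by rewrite unitmxE h1 unitr1.
have [f f_orbit fh] := adherent_seq (lower_orbit_dense g01 e0 g0e h1).
(* [E j] tends to the identity and carries the basis [h] of u_B x to a basis of a lattice in the
   orbit of x_0. *)
pose E j := f j *m invmx h.
have E1 : mxlim \oo E 1%:M.
  by rewrite -(mulmxV hu); apply: mxlimM fh (mxlim_cst _).
have lim_ul : mxlim \oo (fun j => ulsubmx (E j)) 1%:M.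
  by have := mxlim_ulsub E1; rewrite scalar_mx_block block_mxKul.
have lim_ur : mxlim \oo (fun j => ursubmx (E j)) 0.
  by have := mxlim_ursub E1; rewrite scalar_mx_block block_mxKur.
have lim_dl : mxlim \oo (fun j => dlsubmx (E j)) 0.
  by have := mxlim_dlsub E1; rewrite scalar_mx_block block_mxKdl.
have lim_dr : mxlim \oo (fun j => drsubmx (E j)) 1%:M.
  by have := mxlim_drsub E1; rewrite scalar_mx_block block_mxKdr.
have det10 p : \det (1%:M : 'M[R]_p) != 0 by rewrite det1 oner_neq0.
have lim_a : mxlim \oo (fun j => invmx (ulsubmx (E j))) 1%:M.
  by rewrite -invmx1; exact: mxlim_inv.
have lim_A : mxlim \oo (fun j => invmx (ulsubmx (E j)) *m ursubmx (E j)) 0.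
  by rewrite -(mulmx0 _ 1%:M); exact: mxlimM.
(* Schur complement for the factorization E = P u_A with P block lower triangular and A = E11^-1
   E12; A tends to 0 and both diagonal blocks of P tend to the identity. *)
pose S j := drsubmx (E j) - dlsubmx (E j) *m (invmx (ulsubmx (E j)) *m ursubmx (E j)).
have lim_S : mxlim \oo S 1%:M.
  rewrite -[X in mxlim _ _ X]subr0 -(mul0mx _ (0 : 'M[R]_(m.+1, n.+1))).
  by apply: mxlimD => //; apply: mxlimN; exact: mxlimM.
have lim_b : mxlim \oo (fun j => invmx (S j)) 1%:M.
  by rewrite -invmx1; exact: mxlim_inv.
have [j [[[Eu Su] [E11 a1]] [[S1 b1] A0]]] := filter_ex (filterI
  (filterI (filterI (near_det_neq0 lim_ul (det10 _)) (near_det_neq0 lim_S (det10 _)))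
           (filterI (mxlim_dist e10 lim_ul) (mxlim_dist e10 lim_a)))
  (filterI (filterI (mxlim_dist e20 lim_S) (mxlim_dist e20 lim_b))
           (mxlim_dist s0 lim_A))).
have [c [z [zu fE]]] := f_orbit j.
set a := invmx _ in a1 A0; set b := invmx _ in b1.
set A := a *m _ in A0.
have {}Eu : ulsubmx (E j) \in unitmx by rewrite unitmxE unitfE.
have {}Su : S j \in unitmx by rewrite unitmxE unitfE.
pose P := block_mx (ulsubmx (E j)) 0 (dlsubmx (E j)) (S j).
pose Q := block_mx a 0 (- (b *m dlsubmx (E j) *m a)) b.
have QP : Q *m P = 1%:M.
  rewrite mulmx_block !(mul0mx, mulmx0, addr0, add0r) !mulVmx//.
  by rewrite mulNmx -!mulmxA mulVmx// mulmx1 addNr -scalar_mx_block.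
have EP : E j = P *m u_mx A.
  rewrite mulmx_block !(mul0mx, mulmx0, addr0, add0r, mulmx1) mulKVmx//.
  by rewrite -[LHS]submxK addrC subrK.
(* Since u_A commutes with u_B, u_(A+B) g = P^-1 E h = P^-1 f_j, which is p g_0 up to a change of
   integral basis. *)
pose p := Q *m lower_mx c.
have uAB : u_mx (A + B) *m g = p *m g0 *m map_mx intr z.
  have -> : u_mx (A + B) *m g = Q *m (E j *m h).
    rewrite EP !mulmxA QP mul1mx; congr (_ *m _).
    by rewrite mulmx_block !(mul0mx, mulmx0, mul1mx, mulmx1, addr0, add0r) addrC.
  by rewrite /E mulmxKV// fE /p !mulmxA.
(* Although [c] is arbitrary, it only enters the lower left block of p; the diagonal blocks [a] and
   [b] are close to the identity. *)
have pE : p = block_mx a 0 (b *m c - b *m dlsubmx (E j) *m a) b.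
  by rewrite /p mulmx_block !(mul0mx, mulmx0, mulmx1, addr0, add0r) addrC.
have pV : p *m block_mx (ulsubmx (E j)) 0 (dlsubmx (E j) - c *m ulsubmx (E j)) (S j) = 1%:M.
  have -> : block_mx (ulsubmx (E j)) 0 (dlsubmx (E j) - c *m ulsubmx (E j)) (S j) =
      lower_mx (- c) *m P.
    by rewrite mulmx_block !(mul0mx, mulmx0, mul1mx, addr0, add0r) mulNmx addrC.
  rewrite /p mulmxA -(mulmxA Q) lower_mxM subrr -[RHS]QP; congr (_ *m _).
  by rewrite /lower_mx -scalar_mx_block mulmx1.
exists (A + B); split.
  apply: sO; split => // i i'; rewrite /ball /= mxE opprD addrCA subrr addr0 normrN.
  by have := A0 i i'; rewrite mxE sub0r normrN.
rewrite /= lattice_actE uAB lattice_of_zmx//.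
have [l' -> [ll' l'l]] := lambda_parabolic hrho hsigma k0 g0u pE pV
  (rhok _ a1) (sigmak _ b1) (rhok _ E11) (sigmak _ S1) gl.
exists l' => //; apply: rI; rewrite /ball /=.
have rl : r / (2 * l) * l = r / 2 by rewrite invfM mulrA divfK ?gt_eqF.
have rl0 : 0 < r / (2 * l) by rewrite divr_gt0// mulr_gt0.
have C1 : 1 <= (1 + k + k) ^+ (m.+1 + n.+1).
  by rewrite exprn_ege1// -addrA lerDl addr_ge0// ltW.
move: ll' l'l C1 kd; move: (_ ^+ _) => C ll' l'l C1 kd.
(* Both bounds follow from l <= C l', l' <= C l and C l <= l + r/2. *)
rewrite ltr_norml; apply/andP; split; last by nra.
by nra.
Qed.
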